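(* Let $\alpha,\beta\in C(E_1,E_2)$ with $\alpha,\beta\in\mathcal X$ and $\alpha\le\beta$ on $E_1$, where $\alpha$ is a subsolution and $\beta$ a supersolution of $u''=f(y,u,u')$. Then there exists a global solution $u$ of $u''=f(y,u,u')$ on $E_1$ satisfying $\alpha\le u\le\beta$ on $E_1$.
   Context: $E_1,E_2\subseteq\mathbb R$ are open intervals and $E_2\subseteq\tilde E_2\subseteq\overline{E_2}$. $f:E_1\times\tilde E_2\times\mathbb R\to\mathbb R$ is continuous and locally Lipschitz on $E_1\times E_2\times\mathbb R$. For $C\in(0,\infty]$ let $f_C(y,u,v)=f(y,u,(-C)\vee v\wedge C)$ (so $f_\infty=f$). Nagumo condition (assumed): for every compact $K\subset E_1\times\tilde E_2$ there is $\varphi:[0,\infty)\to\mathbb R$ with $\int_r^\infty\frac{s}{\varphi(s)}ds=\infty$ for all $r>0$ and $|f_C(y,u,v)|\le\varphi(|v|)$ for all $(y,u)\in K$, $v\in\mathbb R$, $C\in(0,\infty]$. A function $\alpha\in C(E_1,\tilde E_2)$ is a subsolution if for each $y\in E_1$ either $\alpha$ is $C^2$ near $y$ with $\alpha''(y)\ge f(y,\alpha(y),\alpha'(y))$, or $\alpha$ has finite one-sided derivatives at $y$ with $D^-\alpha(y)<D^+\alpha(y)$; $\beta\in C(E_1,\tilde E_2)$ is a supersolution if for each $y$ either $\beta$ is $C^2$ near $y$ with $\beta''(y)\le f(y,\beta(y),\beta'(y))$, or $D^-\beta(y)>D^+\beta(y)$ (finite). Here $D^-,D^+$ are left and right derivatives.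 $\mathcal X=\{\gamma\in C(E_1,\tilde E_2):\ \sup_{y\in D(\gamma)\cap K}|\gamma'(y)|<\infty$ for every compact $K\subset E_1\}$, where $D(\gamma)$ is the set where $\gamma$ is differentiable. A global solution is a $C^2$ function $u:E_1\to\tilde E_2$ satisfying $u''(y)=f(y,u(y),u'(y))$ for all $y\in E_1$. *)

(* Defs.v *)
From HB Require Import structures.
From mathcomp Require Import all_boot all_order all_algebra.
From mathcomp Require Import all_classical all_reals all_analysis.
Set Implicit Arguments. Unset Strict Implicit. Unset Printing Implicit Defensive.
Import Order.TTheory GRing.Theory Num.Theory.
Import numFieldNormedType.Exports.
Local Open Scope classical_set_scope.
Local Open Scope ring_scope.

Section Defs.
Variable R : realType.

Definition open_interval (E : set R) : Prop :=
  exists a b : \bar R, (a < b)%E /\ E = [set x | (a < x%:E)%E /\ (x%:E < b)%E].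

Definition cont_on3 (S : R -> R -> Prop) (f : R -> R -> R -> R) : Prop :=
  forall y0 u0 v0, S y0 u0 -> forall eps : R, 0 < eps -> exists d : R, 0 < d /\
    forall y u v, S y u -> `|y - y0| < d -> `|u - u0| < d -> `|v - v0| < d ->
      `|f y u v - f y0 u0 v0| < eps.

Definition loc_lipschitz_on3 (S : R -> R -> Prop) (f : R -> R -> R -> R) : Prop :=
  forall y0 u0 v0, S y0 u0 -> exists e L : R, 0 < e /\
    forall y u v y' u' v',
      `|y - y0| < e -> `|u - u0| < e -> `|v - v0| < e ->
      `|y' - y0| < e -> `|u' - u0| < e -> `|v' - v0| < e ->
      `|f y u v - f y' u' v'| <= L * (`|y - y'| + `|u - u'| + `|v - v'|).

Definition fC (f : R -> R -> R -> R) (C : R) (y u v : R) : R :=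
  f y u (Num.max (- C) (Num.min v C)).

(* Nagumo condition: for every compact K in E1 x E2t there is phi with
   int_r^oo s/phi(s) ds = +oo for all r > 0 and |f_C| <= phi(|v|) on K x R
   for every C in (0, +oo] (C = +oo meaning f itself). *)
Definition nagumo (E1 E2t : set R) (f : R -> R -> R -> R) : Prop :=
  forall K : set (R * R), compact K -> K `<=` [set p | E1 p.1 /\ E2t p.2] ->
  exists phi : R -> R,
    (forall r : R, 0 < r ->
       (\int[lebesgue_measure]_(s in `[r, +oo[%classic)
           ((s%:E) * ((phi s)%:E)^-1))%E = +oo%E) /\
    (forall p, K p -> forall v : R,
       `|f p.1 p.2 v| <= phi `|v| /\
       (forall C : R, 0 < C -> `|fC f C p.1 p.2 v| <= phi `|v|)).

Definition C2_near (g : R -> R) (y : R) : Prop :=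
  exists e : R, 0 < e /\ forall z, `|z - y| < e ->
    derivable g z 1 /\ derivable ((g^`())%classic) z 1 /\ {for z, continuous (g^`()^`())%classic}.

Definition left_deriv (g : R -> R) (y l : R) : Prop :=
  (fun h : R => h^-1 * (g (y + h) - g y)) @ 0^'- --> l.
Definition right_deriv (g : R -> R) (y l : R) : Prop :=
  (fun h : R => h^-1 * (g (y + h) - g y)) @ 0^'+ --> l.

Definition subsolution (E1 : set R) (f : R -> R -> R -> R) (a : R -> R) : Prop :=
  forall y, E1 y ->
    (C2_near a y /\ f y (a y) ((a^`())%classic y) <= (a^`()^`())%classic y) \/
    (exists lm lp : R, left_deriv a y lm /\ right_deriv a y lp /\ lm < lp).

Definition supersolution (E1 : set R) (f : R -> R -> R -> R) (b : R -> R) : Prop :=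
  forall y, E1 y ->
    (C2_near b y /\ (b^`()^`())%classic y <= f y (b y) ((b^`())%classic y)) \/
    (exists lm lp : R, left_deriv b y lm /\ right_deriv b y lp /\ lm > lp).

Definition cont_into (E1 E : set R) (g : R -> R) : Prop :=
  forall y, E1 y -> E (g y) /\ {for y, continuous g}.

Definition classX (E1 E2t : set R) (g : R -> R) : Prop :=
  cont_into E1 E2t g /\
  forall K : set R, compact K -> K `<=` E1 ->
    exists M : R, forall y, K y -> derivable g y 1 -> `|(g^`())%classic y| <= M.

Definition global_solution (E1 E2t : set R) (f : R -> R -> R -> R) (u : R -> R) : Prop :=
  forall y, E1 y -> E2t (u y) /\ derivable u y 1 /\ derivable ((u^`())%classic) y 1 /\
    {for y, continuous (u^`()^`())%classic} /\ (u^`()^`())%classic y = f y (u y) ((u^`())%classic y).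

End Defs.

(* Main.v *)
Require Import Defs.
From HB Require Import structures.
From mathcomp Require Import all_boot all_order all_algebra.
From mathcomp Require Import all_classical all_reals all_analysis.
From mathcomp Require Import measurable_realfun ring lra.
Import Order.TTheory GRing.Theory Num.Theory.
Import numFieldNormedType.Exports.
Local Open Scope classical_set_scope.
Local Open Scope ring_scope.
Set Implicit Arguments. Unset Strict Implicit. Unset Printing Implicit Defensive.

(** Between [alpha] and [beta] the right-hand side [f] is locally Lipschitz, so
    on a compact interval [[a, b]] of [E1] the equation can be truncated to one
    with a bounded, globally Lipschitz right-hand side.  Its Dirichlet problem
    with data [alpha a], [alpha b] is solved by shooting; the truncation repels
    solutions from the outside of the strip [alpha <= u <= beta], so the maximum
    principle keeps [u] inside (at a corner of [alpha] or [beta] no touching is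
    possible), and the Nagumo condition bounds [u'] by a constant below the
    level at which it was truncated.  For an exhaustion [[a_n, b_n]] of [E1] the
    Cauchy data of these solutions at a fixed point have a cluster point; by
    continuous dependence the solution issued from it stays in the strip on
    every [[a_n, b_n]], and by uniqueness these solutions glue together. *)

(** * Derivatives and antiderivatives *)

(** The order of choices shapes the argument. The slope level [N] must be fixed before [f] is cut
    off at it, so it is computed from [f] on the rectangle [[a, b] x [m, M]], where [m] is the
    minimum of [alpha] and [M] the maximum of [beta]; both lie in the interval [E2], hence [f] is
    Lipschitz there. [N] also dominates the slopes of [alpha] and [beta], so the cut-off leaves
    their differential inequalities intact. The maximum principle needs strict inequalities outside
    the strip; they come from a penalty that is bounded, Lipschitz, zero inside the strip and of the
    sign of the excess. In the limit no compactness in a function space is used: two Cauchy data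
    determine a solution, and a solution on a larger interval obeys the slope bound of each smaller
    one, so the data stay in a fixed plane rectangle. The truncated equations change with the
    interval; they are compared only through [f], with which each agrees on the strip below its
    slope level. *)

Lemma is_derive_continuous (R : realType) (g : R -> R) (x d : R) :
  is_derive x 1 g d -> {for x, continuous g}.
Proof.
by move=> H; apply/differentiable_continuous/derivable1_diffP; apply: ex_derive.
Qed.

Lemma is_deriveDf (R : realType) (f g : R -> R) (x a b : R) :
  is_derive x 1 f a -> is_derive x 1 g b -> is_derive x 1 (fun t => f t + g t) (a + b).
Proof. exact: is_deriveD. Qed.

Lemma is_deriveNf (R : realType) (f : R -> R) (x a : R) :
  is_derive x 1 f a -> is_derive x 1 (fun t => - f t) (- a).
Proof. exact: is_deriveN. Qed.

Lemma is_deriveBf (R : realType) (f g : R -> R) (x a b : R) :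
  is_derive x 1 f a -> is_derive x 1 g b -> is_derive x 1 (fun t => f t - g t) (a - b).
Proof. exact: is_deriveB. Qed.

Lemma is_deriveMf (R : realType) (f g : R -> R) (x a b : R) :
  is_derive x 1 f a -> is_derive x 1 g b ->
  is_derive x 1 (fun t => f t * g t) (f x * b + g x * a).
Proof. exact: is_deriveM. Qed.

Lemma is_derive_cstf (R : realType) (c x : R) : is_derive x 1 (fun=> c) 0.
Proof. exact: is_derive_cst. Qed.

Lemma is_derive_scale (R : realType) (c x : R) : is_derive x 1 (fun t => c * t) c.
Proof.
have h : is_derive x 1 (fun t : R => t) 1 by exact: is_derive_id.
by refine (is_derive_eq (is_deriveMf (is_derive_cstf c x) h) _); rewrite mulr1 mulr0 addr0.
Qed.

Lemma is_derive_compN (R : realType) (f : R -> R) (x a : R) :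
  is_derive (- x) 1 f a -> is_derive x 1 (fun t => f (- t)) (- a).
Proof.
move=> h; have hN : is_derive x 1 (fun t : R => - t) (-1).
  by apply: is_deriveNf; exact: is_derive_id.
by refine (is_derive_eq (is_derive1_comp h hN) _); rewrite mulrN1.
Qed.

Lemma is_derive_expR_scale (R : realType) (c x : R) :
  is_derive x 1 (fun t => expR (c * t)) (c * expR (c * x)).
Proof.
have h := is_derive_scale c x.
by refine (is_derive_eq (is_derive1_comp (is_derive_expR (c * x)) h) _); rewrite mulrC.
Qed.

Lemma is_derive_ge0_le (R : realType) (g dg : R -> R) (a b : R) : a <= b ->
  (forall t, a <= t <= b -> is_derive t 1 g (dg t)) ->
  (forall t, a <= t <= b -> 0 <= dg t) -> g a <= g b.
Proof.
move=> ab Dg dg0; have [//| |c] := @MVT_segment R g dg a b ab.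
- by move=> x /[!in_itv]/= /andP[/ltW ax /ltW xb]; apply: Dg; rewrite ax.
- apply: continuous_in_subspaceT => x /[!inE]/= /[!in_itv]/= hx.
  exact: is_derive_continuous (Dg _ hx).
- rewrite in_itv/= => /dg0 c0 e; rewrite -subr_ge0 e mulr_ge0 ?subr_ge0//.
Qed.

(** Both [h - g] and [h + g] are nondecreasing. This stands in for estimating an integral of [dg]
    throughout. *)
Lemma is_derive_norm_le (R : realType) (g dg h dh : R -> R) (a b : R) : a <= b ->
  (forall t, a <= t <= b -> is_derive t 1 g (dg t)) ->
  (forall t, a <= t <= b -> is_derive t 1 h (dh t)) ->
  (forall t, a <= t <= b -> `|dg t| <= dh t) -> `|g b - g a| <= h b - h a.
Proof.
move=> ab Dg Dh gh.
have h1 : h a - g a <= h b - g b.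
  apply: (@is_derive_ge0_le _ (fun t => h t - g t) (fun t => dh t - dg t) _ _ ab).
  - by move=> t ht; apply: is_deriveBf; [exact: Dh|exact: Dg].
  - by move=> t /gh; rewrite ler_norml subr_ge0 => /andP[].
have h2 : h a + g a <= h b + g b.
  apply: (@is_derive_ge0_le _ (fun t => h t + g t) (fun t => dh t + dg t) _ _ ab).
  - by move=> t ht; apply: is_deriveDf; [exact: Dh|exact: Dg].
  - by move=> t /gh; rewrite ler_norml => /andP[? _]; lra.
rewrite ler_norml; apply/andP; split; lra.
Qed.

Lemma is_derive_eq0 (R : realType) (g : R -> R) (r : R) :
  (forall t : R, `|t| <= r -> is_derive t 1 g 0) -> forall t : R, `|t| <= r -> g t = g 0.
Proof.
move=> Dg t; rewrite ler_norml => /andP[t1 t2]; apply/eqP; rewrite -subr_eq0 -normr_le0.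
have z (s : R) : is_derive s 1 (fun _ : R => 0 : R) 0 by exact: is_derive_cst.
have [t0|/ltW t0] := leP 0 t.
- have := @is_derive_norm_le _ g (fun=> 0) (fun=> 0) (fun=> 0) 0 t t0.
  rewrite subrr; apply => // s /andP[s0 s1]; first by apply: Dg; rewrite ler_norml; apply/andP; split; lra.
  by rewrite normr0.
- rewrite distrC; have := @is_derive_norm_le _ g (fun=> 0) (fun=> 0) (fun=> 0) t 0 t0.
  rewrite subrr; apply => // s /andP[s0 s1]; first by apply: Dg; rewrite ler_norml; apply/andP; split; lra.
  by rewrite normr0.
Qed.

Lemma antiderivative_bounded (R : realType) (g : R -> R) (T : R) : continuous g -> 0 < T ->
  exists G : R -> R, G 0 = 0 /\ forall x : R, `|x| < T -> is_derive x 1 G (g x).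
Proof.
move=> cg T0.
(* Integrating from [- T] instead of [0] puts every [x] of []- T, T[], of either sign, inside the
   range of integration. *)
pose F := fun x : R => \int[lebesgue_measure]_(t in [set` Interval (BLeft (- T)) (BRight x)]) g t.
exists (fun x => F x - F 0); split; first by rewrite subrr.
move=> x; rewrite ltr_norml => /andP[x1 x2].
have int : lebesgue_measure.-integrable [set` Interval (BLeft (- T)) (BRight T)] (EFin \o g).
  apply: continuous_compact_integrable; first exact: segment_compact.
  exact: continuous_subspaceT.
have [|d e] := @continuous_FTC1 R g (BLeft (- T)) x T x2 int _ (cg x).
  by rewrite /= lte_fin.
have h : is_derive x 1 F (g x).
  by rewrite -e derive1E; apply/derivableP.
by refine (is_derive_eq (is_deriveBf h (is_derive_cstf (F 0) x)) _); rewrite subr0.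
Qed.

(** Normalised at [0], the antiderivatives on growing intervals coincide where both are defined, so
    they glue. The Picard operator can then act on functions on the whole line. *)
Lemma antiderivative (R : realType) (g : R -> R) : continuous g ->
  exists G : R -> R, G 0 = 0 /\ forall x : R, is_derive x 1 G (g x).
Proof.
move=> cg.
have /choice [G hG] : forall n : nat, exists G : R -> R,
    G 0 = 0 /\ forall x : R, `|x| < n.+1%:R -> is_derive x 1 G (g x).
  by move=> n; apply: antiderivative_bounded.
have agree (x : R) (m n : nat) : `|x| < m.+1%:R -> `|x| < n.+1%:R -> G m x = G n x.
  move=> xm xn; apply/eqP; rewrite -subr_eq0; apply/eqP.
  have := @is_derive_eq0 R (fun t => G m t - G n t) `|x|.
  rewrite (hG m).1 (hG n).1 subr0; apply => // t tx.
  have h1 := (hG m).2 t (le_lt_trans tx xm).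
  have h2 := (hG n).2 t (le_lt_trans tx xn).
  by refine (is_derive_eq (is_deriveBf h1 h2) _); rewrite subrr.
exists (fun x => G (Num.truncn `|x|) x); split; first exact: (hG _).1.
move=> x; have xN := truncnS_gt `|x|; set N := Num.truncn `|x| in xN *.
refine (near_eq_is_derive _ ((hG N).2 x xN)).
have : \forall y \near x, `|y| < N.+1%:R.
  have /cvgr_lt := (@norm_continuous _ R^o x : Num.norm z @[z --> x] --> `|x|).
  by apply.
apply: filterS => y yN; apply: agree => //; exact: truncnS_gt.
Qed.

(** * Initial value problems *)

Lemma ler_div_pow2 (R : realType) (c e : R) : 0 < e -> exists n : nat, c / 2 ^+ n <= e.
Proof.
move=> e0; exists (Num.truncn (c / e)).+1.
rewrite ler_pdivrMr ?exprn_gt0// mulrC -ler_pdivrMr//.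
apply: (le_trans (ltW (truncnS_gt _))).
by rewrite -natrX ler_nat ltnW// ltn_expl.
Qed.

(** The intervals of centre [x n] and radius [2 * C / 2 ^+ n] are nested; [l] is the supremum of
    their left ends. *)
Lemma geometric_limit (R : realType) (x : nat -> R) (C : R) :
  (forall n, `|x n.+1 - x n| <= C / 2 ^+ n) ->
  exists l, forall n, `|l - x n| <= 2 * C / 2 ^+ n.
Proof.
move=> hx.
have e2 n : C / 2 ^+ n = 2 * (C / 2 ^+ n.+1).
  by rewrite exprS; field; rewrite expf_neq0.
pose y n := x n - 2 * C / 2 ^+ n; pose z n := x n + 2 * C / 2 ^+ n.
have yS n : y n <= y n.+1.
  have := hx n; have := e2 n; rewrite /y -!mulrA ler_norml => h /andP[? ?]; lra.
have zS n : z n.+1 <= z n.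
  have := hx n; have := e2 n; rewrite /z -!mulrA ler_norml => h /andP[? ?]; lra.
have yz n : y n <= z n.
  have : 0 <= C / 2 ^+ n by apply: le_trans (hx n).
  rewrite /y /z -!mulrA; lra.
have ym : {homo y : m n / (m <= n)%N >-> m <= n}.
  by apply: homo_leq => // n m k; exact: le_trans.
have zm : {homo z : m n / (m <= n)%N >-> n <= m}.
  apply: (@homo_leq _ z (fun a b => b <= a)) => // a b c ab bc; exact: le_trans bc ab.
have yzmn m n : y m <= z n.
  have := ym m (maxn m n) (leq_maxl _ _); have := zm n (maxn m n) (leq_maxr _ _).
  have := yz (maxn m n); lra.
have ne : range y !=set0 by exists (y 0%N), 0%N.
have ub n : ubound (range y) (z n) by move=> _ [m _ <-].
exists (sup (range y)) => n.
have h1 : y n <= sup (range y) by apply: ub_le_sup; [exists (z 0%N); exact: ub|exists n].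
have h2 : sup (range y) <= z n by apply: ge_sup.
rewrite ler_norml; apply/andP; rewrite /y /z in h1 h2; split; lra.
Qed.

Lemma continuous_near_approx (R : realType) (f : R -> R) (x : R) :
  (forall e : R, 0 < e -> exists g : R -> R,
     {for x, continuous g} /\ \forall y \near x, `|f y - g y| <= e) ->
  {for x, continuous f}.
Proof.
move=> H; apply/cvgrPdist_le => e e0.
have e3 : 0 < e / 3 by lra.
have [g [cg fg]] := H _ e3.
move/cvgrPdist_le : cg => /(_ _ e3) cg.
have fgx := nbhs_singleton fg.
near=> y.
have h1 : `|f y - g y| <= e / 3 by near: y.
have h2 : `|g x - g y| <= e / 3 by near: y.
have -> : f x - f y = (f x - g x) + (g x - g y) - (f y - g y) by lra.
apply: (le_trans (ler_normB _ _)); apply: (le_trans (lerD (ler_normD _ _) (lexx _))).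
lra.
Unshelve. all: by end_near.
Qed.

(* Bielecki's weight: in the norm [sup |g| / weight] the Picard operator is a
   contraction on the whole line. *)
Definition weight (R : realType) (K t0 t : R) : R :=
  expR (K * (t - t0)) + expR (- K * (t - t0)).

Lemma is_derive_expR_shift (R : realType) (c t0 x : R) :
  is_derive x 1 (fun t => expR (c * (t - t0))) (c * expR (c * (x - t0))).
Proof.
have h : is_derive x 1 (fun t => c * (t - t0)) c.
  have h1 : is_derive x 1 (fun t : R => t - t0) (1 - 0).
    by apply: is_deriveBf.
  by refine (is_derive_eq (is_deriveMf (is_derive_cstf c x) h1) _); rewrite subr0 mulr1 mulr0 addr0.
by refine (is_derive_eq (@is_derive1_comp R expR (fun t => c * (t - t0)) x _ _ (is_derive_expR _) h) _); rewrite mulrC.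
Qed.

Lemma weight_ge1 (R : realType) (K t0 t : R) : 1 <= weight K t0 t.
Proof.
rewrite /weight; have [h|h] := leP 0 (K * (t - t0)).
- have := expR_ge1Dx (K * (t - t0)); have := expR_gt0 (- K * (t - t0)); lra.
- have := expR_ge1Dx (- K * (t - t0)); rewrite {1}mulNr.
  have := expR_gt0 (K * (t - t0)); lra.
Qed.

Lemma weight_continuous (R : realType) (K t0 : R) : continuous (weight K t0).
Proof.
by move=> t; apply: is_derive_continuous.
Qed.

(** [S] is the antiderivative of [C * weight] vanishing at [t0], and it is dominated by
    [C / K * weight] on both sides of [t0]: each integration gains a factor [1 / K]. *)
Lemma weight_integral_le (R : realType) (K t0 C : R) (g dg : R -> R) :
  0 < K -> 0 <= C -> (forall t : R, is_derive t 1 g (dg t)) -> g t0 = 0 ->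
  (forall t, `|dg t| <= C * weight K t0 t) ->
  forall t, `|g t| <= C / K * weight K t0 t.
Proof.
move=> K0 C0 Dg g0 hg t.
pose S t := C / K * (expR (K * (t - t0)) - expR (- K * (t - t0))).
have DS (s : R) : is_derive s 1 S (C * weight K t0 s).
  have h := is_deriveBf (is_derive_expR_shift K t0 s) (is_derive_expR_shift (- K) t0 s).
  refine (is_derive_eq (is_deriveMf (is_derive_cstf (C / K) s) h) _).
  by rewrite /weight; field; rewrite gt_eqF.
have S0 : S t0 = 0 by rewrite /S subrr !mulr0 subrr mulr0.
have CK : 0 <= C / K by rewrite divr_ge0 // ltW.
have SW1 : S t <= C / K * weight K t0 t.
  by apply: ler_wpM2l => //; rewrite /weight; have := expR_gt0 (- K * (t - t0)); lra.
have SW2 : - S t <= C / K * weight K t0 t.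
  rewrite -mulrN; apply: ler_wpM2l => //; rewrite /weight.
  have := expR_gt0 (K * (t - t0)); lra.
have [t0t|/ltW tt0] := leP t0 t.
- have := @is_derive_norm_le _ g dg S _ t0 t t0t (fun s _ => Dg s) (fun s _ => DS s) (fun s _ => hg s).
  rewrite g0 S0 !subr0; lra.
- have := @is_derive_norm_le _ g dg S _ t t0 tt0 (fun s _ => Dg s) (fun s _ => DS s) (fun s _ => hg s).
  rewrite g0 S0 distrC !subr0 sub0r; lra.
Qed.

(** The second-order equation as a first-order system. Derivatives are two-sided even at end points
    of [D]; this is available because the solutions constructed below come from equations solved on
    the whole line. *)
Definition solves_on (R : realType) (D : set R) (F : R -> R -> R -> R) (u v : R -> R) : Prop :=
  forall t : R, D t -> is_derive t 1 u (v t) /\ is_derive t 1 v (F t (u t) (v t)).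

Definition lipschitz2 (R : realType) (L : R) (F : R -> R -> R -> R) : Prop :=
  forall t u v u' v', `|F t u v - F t u' v'| <= L * (`|u - u'| + `|v - v'|).

(* Joint continuity of [F], in the only form in which it is needed. *)
Definition nemytskii_continuous (R : realType) (F : R -> R -> R -> R) : Prop :=
  forall u v : R -> R, continuous u -> continuous v -> continuous (fun t => F t (u t) (v t)).

(** The unknown of the fixed point problem is [v] alone: [U v] recovers the first component by
    integration, and [T] integrates the right-hand side. The limit of the iterates is taken
    pointwise; it is continuous because the weight is bounded near each point. *)
Lemma picard (R : realType) (F : R -> R -> R -> R) (L B t0 p q : R) :
  0 <= L -> lipschitz2 L F -> nemytskii_continuous F ->
  (forall t u v, `|F t u v| <= B) ->
  exists u v, [/\ u t0 = p, v t0 = q & solves_on setT F u v].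
Proof.
move=> L0 LF cF BF.
(* [P] is integration from [t0]; its value on discontinuous functions is a dummy. *)
have /choice [P hP] : forall g : R -> R, exists G : R -> R, continuous g ->
    G t0 = 0 /\ forall x : R, is_derive x 1 G (g x).
  move=> g; have [cg|//] := pselect (continuous g); last by exists g.
  have [G [_ DG]] := antiderivative cg.
  exists (fun t => G t - G t0) => _; split; first by rewrite subrr.
  move=> x; refine (is_derive_eq (is_deriveBf (DG x) (is_derive_cstf (G t0) x)) _).
  by rewrite subr0.
have cP g : continuous g -> continuous (P g).
  by move=> /hP[_ D] x; exact: is_derive_continuous (D x).
have cadd c g : continuous g -> continuous (fun t : R => c + g t : R).
  by move=> cg x; apply: cvgD; [exact: cvg_cst|exact: cg].
pose U v (t : R) := p + P v t.
pose T v (t : R) := q + P (fun s => F s (U v s) (v s)) t.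
have cU v : continuous v -> continuous (U v) by move=> ?; apply: cadd; exact: cP.
have cFv v : continuous v -> continuous (fun s => F s (U v s) (v s)).
  by move=> ?; apply: cF => //; exact: cU.
have cT v : continuous v -> continuous (T v).
  by move=> ?; apply: cadd; apply: cP; exact: cFv.
(* The Lipschitz bound sees both components, so [T] has factor [2 * L / K <= 1 / 2], while
   [1 / K <= 1] keeps [U] from expanding. *)
pose K := 4 * L + 1; have K0 : 0 < K by rewrite /K; lra.
pose W := weight K t0.
have W1 t : 1 <= W t by exact: weight_ge1.
have Ustep v w c : continuous v -> continuous w -> 0 <= c ->
    (forall t, `|v t - w t| <= c * W t) -> forall t, `|U v t - U w t| <= c * W t.
  move=> cv cw c0 vw t.
  have h := @weight_integral_le R K t0 c (fun t => P v t - P w t) (fun t => v t - w t) K0 c0.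
  have -> : U v t - U w t = P v t - P w t by rewrite /U; lra.
  apply: le_trans (h _ _ vw t) _.
  - by move=> s; apply: is_deriveBf; [exact: (hP v cv).2|exact: (hP w cw).2].
  - by rewrite (hP v cv).1 (hP w cw).1 subrr.
  - apply: ler_wpM2r; first by have := W1 t; rewrite /W; lra.
    by rewrite ler_pdivrMr// ler_peMr// /K; lra.
have Tstep v w c : continuous v -> continuous w -> 0 <= c ->
    (forall t, `|v t - w t| <= c * W t) -> forall t, `|T v t - T w t| <= c / 2 * W t.
  move=> cv cw c0 vw t.
  have -> : T v t - T w t = P (fun s => F s (U v s) (v s)) t - P (fun s => F s (U w s) (w s)) t.
    by rewrite /T; lra.
  have Lc0 : 0 <= 2 * L * c by rewrite !mulr_ge0.
  have h := @weight_integral_le R K t0 (2 * L * c)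
    (fun t => P (fun s => F s (U v s) (v s)) t - P (fun s => F s (U w s) (w s)) t)
    (fun t => F t (U v t) (v t) - F t (U w t) (w t)) K0 Lc0.
  apply: le_trans (h _ _ _ t) _.
  - by move=> s; apply: is_deriveBf; [exact: (hP _ (cFv v cv)).2|exact: (hP _ (cFv w cw)).2].
  - by rewrite (hP _ (cFv v cv)).1 (hP _ (cFv w cw)).1 subrr.
  - move=> s; apply: (le_trans (LF _ _ _ _ _)).
    have -> : 2 * L * c * W s = L * (c * W s + c * W s) by ring.
    by apply: ler_wpM2l => //; apply: lerD => //; exact: Ustep.
  - apply: ler_wpM2r; first by have := W1 t; rewrite /W; lra.
    rewrite ler_pdivrMr// /K; have := mulr_ge0 L0 c0; lra.
pose vn n := iter n T (fun=> q).
have cvn n : continuous (vn n).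
  by elim: n => [|n IH] /=; [move=> x; exact: cvg_cst|exact: cT].
have B0 : 0 <= B by apply: le_trans (BF 0 0 0).
have vnS n t : `|vn n.+1 t - vn n t| <= B * W t / 2 ^+ n.
  have : forall t, `|vn n.+1 t - vn n t| <= B / 2 ^+ n * W t.
    elim: n => [s|n IH].
      rewrite expr0 divr1 /vn /= /T; set g := P _.
      have -> : q + g s - q = g s by lra.
      have h := hP _ (cFv _ (cvn 0%N)).
      apply: le_trans (@weight_integral_le R K t0 B g _ K0 B0 h.2 h.1 _ s) _.
      - by move=> r; apply: (le_trans (BF _ _ _)); rewrite ler_peMr.
      - apply: ler_wpM2r; first by have := W1 s; rewrite /W; lra.
        by rewrite ler_pdivrMr// ler_peMr// /K; lra.
    move=> s; have := Tstep _ _ (B / 2 ^+ n) (cvn n.+1) (cvn n) _ IH s.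
    rewrite exprSr invfM mulrA; apply.
    by rewrite divr_ge0// exprn_ge0.
  by move=> /(_ t); rewrite mulrAC.
have /choice [v hv] : forall t, exists l, forall n, `|l - vn n t| <= 2 * B / 2 ^+ n * W t.
  move=> t; have [l hl] := @geometric_limit R (vn^~ t) _ (vnS^~ t).
  by exists l => n; move: (hl n); rewrite mulrA mulrAC.
have cv : continuous v.
  move=> x; apply: continuous_near_approx => e e0.
  have [n hn] := @ler_div_pow2 R (2 * B * (W x + 1)) e e0.
  exists (vn n); split; first exact: cvn.
  have : \forall y \near x, W y < W x + 1.
    have /cvgr_lt := @weight_continuous R K t0 x; apply; rewrite /W; lra.
  apply: filterS => y Wy; apply: le_trans (hv y n) _; apply: le_trans hn.
  rewrite mulrAC; apply: ler_wpM2r; first by rewrite invr_ge0 exprn_ge0.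
  by apply: ler_wpM2l; rewrite ?mulr_ge0 // ltW.
have B2 n : 0 <= 2 * B / 2 ^+ n by rewrite !mulr_ge0// invr_ge0 exprn_ge0.
have Tv t : v t = T v t.
  apply/eqP; rewrite -subr_eq0 -normr_le0; apply/ler_addgt0Pl => e e0.
  have [n hn] := @ler_div_pow2 R (4 * B * W t) e e0.
  rewrite addr0; apply: le_trans hn.
  have -> : v t - T v t = (v t - vn n.+1 t) - (T v t - T (vn n) t) by rewrite /vn/=; lra.
  apply: (le_trans (ler_normB _ _)).
  have h1 := hv t n.+1; have h2 := Tstep _ _ _ cv (cvn n) (B2 n) (hv^~ n) t.
  have e1 : 2 * B / 2 ^+ n.+1 * W t = B * W t / 2 ^+ n.
    by rewrite exprS; field; rewrite expf_neq0.
  have e2 : 2 * B / 2 ^+ n / 2 * W t = B * W t / 2 ^+ n.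
    by field; rewrite expf_neq0.
  have e3 : 4 * B * W t / 2 ^+ n = 4 * (B * W t / 2 ^+ n) by rewrite !mulrA.
  have : 0 <= B * W t / 2 ^+ n by rewrite -e1 mulr_ge0// (le_trans _ (W1 t)).
  rewrite e1 in h1; rewrite e2 in h2; lra.
exists (U v), v; split.
- by rewrite /U (hP v cv).1 addr0.
- by rewrite Tv /T (hP _ (cFv v cv)).1 addr0.
- move=> t _; split.
  + refine (is_derive_eq (is_deriveDf (is_derive_cstf p t) ((hP v cv).2 t)) _).
    by rewrite add0r.
  + have h := (hP _ (cFv v cv)).2 t.
    refine (near_eq_is_derive (nearW _ (fun s => esym (Tv s))) _).
    refine (is_derive_eq (is_deriveDf (is_derive_cstf q t) h) _).
    by rewrite add0r.
Qed.

(** The two-sided bound on [dE] makes [E * expR (- K * r)] nonincreasing and [E * expR (K * r)]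
    nondecreasing in [r], which covers times after and before [t0]. *)
Lemma gronwall (R : realType) (E dE : R -> R) (K a b t0 t : R) :
  0 <= K -> a <= t0 <= b -> a <= t <= b ->
  (forall s, a <= s <= b -> is_derive s 1 E (dE s)) ->
  (forall s, a <= s <= b -> `|dE s| <= K * E s) -> 0 <= E t0 ->
  E t <= E t0 * expR (K * (b - a)).
Proof.
move=> K0 /andP[a0 b0] /andP[a1 b1] DE hE E0.
have key (c : R) (s : R) : a <= s <= b ->
    is_derive s 1 (fun r => E r * expR (c * r)) ((dE s + c * E s) * expR (c * s)).
  move=> hs; refine (is_derive_eq (is_deriveMf (DE s hs) (is_derive_expR_scale c s)) _).
  ring.
have [t0t|/ltW tt0] := leP t0 t.
- have : - (E t0 * expR (- K * t0)) <= - (E t * expR (- K * t)).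
    apply: (@is_derive_ge0_le _ (fun r => - (E r * expR (- K * r)))
      (fun r => - ((dE r + - K * E r) * expR (- K * r))) _ _ t0t).
    + by move=> s hs; apply: is_deriveNf; apply: key; lra.
    + move=> s hs; rewrite -mulNr mulr_ge0 ?expR_ge0//.
      have /hE : a <= s <= b by lra.
      rewrite ler_norml => /andP[]; lra.
  rewrite lerN2 => h.
  have h2 : E t <= E t0 * expR (K * (t - t0)).
    have -> : E t = E t * expR (- K * t) * expR (K * t).
      by rewrite -mulrA -expRD mulNr addNr expR0 mulr1.
    have -> : K * (t - t0) = - K * t0 + K * t by ring.
    by rewrite expRD mulrA ler_pM2r ?expR_gt0.
  apply: (le_trans h2); apply: ler_wpM2l => //; rewrite ler_expR ler_wpM2l//; lra.
- have h : E t * expR (K * t) <= E t0 * expR (K * t0).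
    apply: (@is_derive_ge0_le _ (fun r => E r * expR (K * r))
      (fun r => (dE r + K * E r) * expR (K * r)) _ _ tt0).
    + by move=> s hs; apply: key; lra.
    + move=> s hs; rewrite mulr_ge0 ?expR_ge0//.
      have /hE : a <= s <= b by lra.
      rewrite ler_norml => /andP[]; lra.
  have h2 : E t <= E t0 * expR (K * (t0 - t)).
    have -> : E t = E t * expR (K * t) * expR (- K * t).
      by rewrite -mulrA -expRD mulNr subrr expR0 mulr1.
    have -> : K * (t0 - t) = K * t0 + - K * t by ring.
    by rewrite expRD mulrA ler_pM2r ?expR_gt0.
  apply: (le_trans h2); apply: ler_wpM2l => //; rewrite ler_expR ler_wpM2l//; lra.
Qed.

(** Gronwall for the squared distance, which is differentiable where the norm is not. With [X], [Y]
    the two distances, the derivative is at most [2XY + 2LY(X + Y)], and [2XY <= X^2 + Y^2] gives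
    the constant [1 + 3 * L]. *)
Lemma solves_on_stable (R : realType) (F : R -> R -> R -> R) (L a b t0 t : R)
    (u1 v1 u2 v2 : R -> R) :
  0 <= L -> lipschitz2 L F -> a <= t0 <= b -> a <= t <= b ->
  solves_on [set s | a <= s <= b] F u1 v1 -> solves_on [set s | a <= s <= b] F u2 v2 ->
  (u1 t - u2 t) ^+ 2 + (v1 t - v2 t) ^+ 2 <=
  ((u1 t0 - u2 t0) ^+ 2 + (v1 t0 - v2 t0) ^+ 2) * expR ((1 + 3 * L) * (b - a)).
Proof.
move=> L0 LF h0 h1 s1 s2.
apply: (@gronwall _ (fun t => (u1 t - u2 t) ^+ 2 + (v1 t - v2 t) ^+ 2)
  (fun t => 2 * (u1 t - u2 t) * (v1 t - v2 t)
     + 2 * (v1 t - v2 t) * (F t (u1 t) (v1 t) - F t (u2 t) (v2 t)))) => //.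
- lra.
- move=> s hs; have [D1 D1'] := s1 s hs; have [D2 D2'] := s2 s hs.
  have du := is_deriveBf D1 D2; have dv := is_deriveBf D1' D2'.
  refine (is_derive_eq (is_deriveDf (is_deriveMf du du) (is_deriveMf dv dv)) _); ring.
- move=> s hs; have := LF s (u1 s) (v1 s) (u2 s) (v2 s).
  set z := F _ _ _ - _; set x := u1 s - u2 s; set y := v1 s - v2 s => hz.
  rewrite -[x ^+ 2]real_normK ?num_real// -[y ^+ 2]real_normK ?num_real//.
  apply: (le_trans (ler_normD _ _)); rewrite !normrM normr_nat.
  move: hz (normr_ge0 x) (normr_ge0 y) (normr_ge0 z).
  move: `|x| `|y| `|z| => X Y Z hz X0 Y0 Z0.
  have i1 : 2 * X * Y <= X ^+ 2 + Y ^+ 2 by have := sqr_ge0 (X - Y); lra.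
  have i2 : 2 * Y * Z <= 2 * Y * (L * (X + Y)) by apply: ler_wpM2l => //; rewrite mulr_ge0.
  have i3 : L * (2 * X * Y) <= L * (X ^+ 2 + Y ^+ 2) by apply: ler_wpM2l.
  have i4 : 0 <= L * X ^+ 2 by rewrite mulr_ge0 ?sqr_ge0.
  lra.
- by rewrite addr_ge0 ?sqr_ge0.
Qed.

(** * The Dirichlet problem for bounded Lipschitz equations *)

Lemma ler_norm_sqr (R : realType) (x y : R) : 0 <= y -> x ^+ 2 <= y ^+ 2 -> `|x| <= y.
Proof. by move=> y0; rewrite -[x ^+ 2]real_normK ?num_real// ler_sqr ?nnegrE. Qed.

Lemma lipschitz_continuous (R : realType) (g : R -> R) (C : R) :
  (forall s t, `|g s - g t| <= C * `|s - t|) -> continuous g.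
Proof.
move=> hg x; apply/cvgrPdist_le => e e0.
have C1 : 0 < `|C| + 1 by have := normr_ge0 C; lra.
near=> y; apply: (le_trans (hg x y)).
have : `|x - y| <= e / (`|C| + 1).
  by near: y; apply: (@cvgr_dist_le _ _ _ _ _ id x) => //; rewrite divr_gt0.
rewrite ler_pdivlMr//; have := ler_norm C; have := normr_ge0 (x - y); nra.
Unshelve. all: by end_near.
Qed.

(* Shooting method: the value at [b] of the solution issued from [a] with slope
   [s] depends continuously on [s] and differs from [A + s (b - a)] by a bounded
   amount, so the intermediate value theorem applies. *)
Lemma dirichlet_problem (R : realType) (F : R -> R -> R -> R) (L B a b A A' : R) :
  a < b -> 0 <= L -> lipschitz2 L F -> nemytskii_continuous F ->
  (forall t u v, `|F t u v| <= B) ->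
  exists u v, [/\ u a = A, u b = A' & solves_on setT F u v].
Proof.
move=> ab L0 LF cF BF.
have /choice [U hU] : forall s : R, exists u : R -> R, exists v,
    [/\ u a = A, v a = s & solves_on setT F u v].
  by move=> s; apply: picard L0 LF cF BF.
have /choice [V hV] := hU.
have B0 : 0 <= B by apply: le_trans (BF 0 0 0).
have ab' : a <= b by exact: ltW.
pose C := expR ((1 + 3 * L) * (b - a)).
have C1 : 1 <= C by apply: le_trans (expR_ge1Dx _); rewrite lerDl mulr_ge0//; lra.
have cg : continuous (fun s => U s b).
  apply: (@lipschitz_continuous _ _ C) => s t.
  have [us vs Ss] := hV s; have [ut vt St] := hV t.
  apply: ler_norm_sqr; first by rewrite mulr_ge0//; lra.
  have ha : a <= a <= b by rewrite lexx. have hb : a <= b <= b by rewrite lexx ab'.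
  have := @solves_on_stable R F L a b a b _ _ _ _ L0 LF ha hb
    (fun r _ => Ss r I) (fun r _ => St r I).
  rewrite us ut vs vt subrr expr0n add0r => h.
  rewrite exprMn real_normK ?num_real//.
  rewrite -/C in h; have := sqr_ge0 (V s b - V t b).
  have : 0 <= (s - t) ^+ 2 * (C * (C - 1)) by rewrite mulr_ge0 ?sqr_ge0// mulr_ge0//; lra.
  lra.
(* Two integrations: the slope stays within [B * (b - a)] of [s], so the end value stays within that
   times [b - a] of the straight line. *)
have est s : `|U s b - A - s * (b - a)| <= B * (b - a) * (b - a).
  have [us vs Ss] := hV s.
  have hv t : a <= t <= b -> `|V s t - s| <= B * (b - a).
    move=> /andP[at_ tb].
    have := @is_derive_norm_le R (V s) _ (fun t => B * t) (fun=> B) a t at_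
      (fun r _ => (Ss r I).2) (fun r _ => is_derive_scale B r) (fun r _ => BF _ _ _).
    rewrite vs => h; apply: (le_trans h); rewrite -mulrBr; apply: ler_wpM2l => //; lra.
  have := @is_derive_norm_le R (fun t => U s t - s * t) (fun t => V s t - s)
      (fun t => B * (b - a) * t) (fun=> B * (b - a)) a b ab'
      (fun r _ => is_deriveBf (Ss r I).1 (is_derive_scale s r))
      (fun r _ => is_derive_scale _ r) hv.
  rewrite us -mulrBr.
  by have -> : U s b - s * b - (A - s * a) = U s b - A - s * (b - a) by ring.
(* At slope [S] the straight line rises by [|A' - A|] plus the error in [est], so the slopes [S] and
   [- S] shoot above and below [A']. *)
pose S := `|A' - A| / (b - a) + B * (b - a).
have S0 : 0 <= S by rewrite addr_ge0 ?divr_ge0 ?mulr_ge0 ?subr_ge0.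
have Se : S * (b - a) = `|A' - A| + B * (b - a) * (b - a).
  by rewrite /S mulrDl divfK// subr_eq0 gt_eqF.
have [| | |s hs us] := @IVT R (fun s => U s b) (- S) S A'.
- by lra.
- exact: continuous_subspaceT.
- have := est S; have := est (- S); rewrite !ler_norml mulNr Se => /andP[h1 h2] /andP[h3 h4].
  have := ler_norm (A' - A); have := ler_norm (- (A' - A)); rewrite normrN => h5 h6.
  by rewrite ge_min le_max; apply/andP; split; apply/orP; [left|right]; lra.
by have [h1 _ h2] := hV s; exists (U s), (V s).
Qed.

(** A Lebesgue number argument: by compactness one large [L] serves at every point as a bound on
    [|f|], as a Lipschitz constant and, through [L^-1], as the radius where that constant is
    valid. *)
Lemma rectangle_lipschitz (R : realType) (S : R -> R -> Prop) (f : R -> R -> R -> R)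
    (a b m M N : R) :
  loc_lipschitz_on3 S f -> (forall y u, a <= y <= b -> m <= u <= M -> S y u) ->
  exists L : R, 1 <= L /\ forall y u v y' u' v' : R,
    a <= y <= b -> m <= u <= M -> - N <= v <= N ->
    a <= y' <= b -> m <= u' <= M -> - N <= v' <= N ->
    `|f y u v - f y' u' v'| <= L * (`|y - y'| + `|u - u'| + `|v - v'|).
Proof.
move=> lf hS.
pose K : set (R * R * R) := (`[a, b]%classic `*` `[m, M]%classic) `*` `[- N, N]%classic.
have cK : compact K by apply: compact_setX; [apply: compact_setX|]; exact: segment_compact.
pose P (L : R) (x : R * R * R) := `|f x.1.1 x.1.2 x.2| <= L /\
  forall y u v, `|x.1.1 - y| < L^-1 -> `|x.1.2 - u| < L^-1 -> `|x.2 - v| < L^-1 ->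
    `|f x.1.1 x.1.2 x.2 - f y u v| <= L * (`|x.1.1 - y| + `|x.1.2 - u| + `|x.2 - v|).
have : \forall L \near +oo, K `<=` P L.
  move/compact_near_coveringP : cK; apply.
  move=> [[y0 u0] v0] [[/=]]; rewrite !in_itv/= => hy hu hv.
  have [e [L0 [e0 hL]]] := lf y0 u0 v0 (hS _ _ hy hu).
  have e2 : 0 < e / 2 by lra.
  exists (ball (y0, u0, v0) (e / 2), [set L | 2 / e <= L /\ L0 <= L /\ 0 < L /\
    `|f y0 u0 v0| + `|L0| * (3 * e) <= L]) => /=.
    split; first exact: nbhsx_ballx.
    near=> L; do !split; near: L; (apply: nbhs_pinfty_ge || apply: nbhs_pinfty_gt); exact: num_real.
  move=> [[[y1 u1] v1] L] /= [[[]]]; rewrite /ball/= => by1 bu1 bv1 [Le [LL0 [Lp Lf]]].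
  have Li : L^-1 <= e / 2.
    by rewrite -[e / 2]invrK lef_pV2 ?posrE ?invr_gt0// invf_div.
  have c (p q r : R) : `|p - q| < e / 2 -> `|q - r| < L^-1 -> `|r - p| < e.
    rewrite !ltr_norml => /andP[? ?] /andP[? ?]; apply/andP; split; lra.
  have c' (p q : R) : `|p - q| < e / 2 -> `|q - p| < e.
    rewrite distrC; lra.
  split => /=.
    have h : `|f y1 u1 v1 - f y0 u0 v0| <= `|L0| * (3 * e).
      apply: (le_trans (hL _ _ _ _ _ _ _ _ _ _ _ _)); rewrite ?subrr ?normr0//; try exact: c'.
      have h1 := c' _ _ by1; have h2 := c' _ _ bu1; have h3 := c' _ _ bv1.
      apply: (@le_trans _ _ (`|L0| * (`|y1 - y0| + `|u1 - u0| + `|v1 - v0|))).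
        by apply: ler_wpM2r; [rewrite !addr_ge0|exact: ler_norm].
      by apply: ler_wpM2l => //; lra.
    have -> : f y1 u1 v1 = (f y1 u1 v1 - f y0 u0 v0) + f y0 u0 v0 by lra.
    apply: (le_trans (ler_normD _ _)); lra.
  move=> y u v hy' hu' hv'.
  apply: (le_trans (hL _ _ _ _ _ _ _ _ _ _ _ _)); try exact: c'; try by [exact: c hy'|exact: c hu'|exact: c hv'].
  by apply: ler_wpM2r => //; rewrite !addr_ge0.
move=> h; have : \forall L \near +oo, K `<=` P L /\ (1 : R) <= L.
  near=> L; split; near: L => //; apply: nbhs_pinfty_ge; exact: num_real.
(* For points at distance [d >= L^-1] only the bound on [|f|] is used: the difference is at most
   [2 * L <= 2 * L * (L * d)]. *)
move=> /filter_ex [L [KP L1]]; exists (2 * L * L); split; first by nra.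
move=> y u v y' u' v' hy hu hv hy' hu' hv'.
have Kin r s t : a <= r <= b -> m <= s <= M -> - N <= t <= N -> K (r, s, t).
  by move=> *; split; [split|] => /=; rewrite in_itv.
have [/= B1 H1] := KP _ (Kin _ _ _ hy hu hv).
have [/= B2 _] := KP _ (Kin _ _ _ hy' hu' hv').
set d := `|y - y'| + `|u - u'| + `|v - v'|.
have p1 := normr_ge0 (y - y'); have p2 := normr_ge0 (u - u'); have p3 := normr_ge0 (v - v').
have [dL|dL] := ltP d L^-1.
  have small r : r <= d -> r < L^-1 by move=> /le_lt_trans; apply.
  apply: (le_trans (H1 _ _ _ (small _ _) (small _ _) (small _ _))).
  - by rewrite /d -addrA lerDl addr_ge0.
  - by rewrite /d addrAC lerDr addr_ge0.
  - by rewrite /d lerDr addr_ge0.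
  apply: ler_wpM2r; [rewrite /d; lra|nra].
have : 1 <= L * d by rewrite -(mulfV (_ : L != 0)) ?ler_pM2l//; [lra|rewrite gt_eqF//; lra].
move=> Ld; apply: (@le_trans _ _ (2 * L)); last nra.
apply: (le_trans (ler_normB _ _)); lra.
Unshelve. all: by end_near.
Qed.

Definition clamp (R : realType) (lo hi x : R) : R := Num.max lo (Num.min x hi).

Lemma clamp_itv (R : realType) (lo hi x : R) : lo <= hi -> lo <= clamp lo hi x <= hi.
Proof. by move=> h; rewrite /clamp le_max lexx/= ge_max h ge_min lexx orbT. Qed.

Lemma clamp_id (R : realType) (lo hi x : R) : lo <= x <= hi -> clamp lo hi x = x.
Proof. by move=> /andP[h1 h2]; rewrite /clamp (min_idPl h2) (max_idPr h1). Qed.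

Lemma clamp_ge (R : realType) (lo hi x : R) : lo <= hi -> hi <= x -> clamp lo hi x = hi.
Proof. by move=> h1 h2; rewrite /clamp (min_idPr h2) (max_idPr h1). Qed.

Lemma clamp_le (R : realType) (lo hi x : R) : lo <= hi -> x <= lo -> clamp lo hi x = lo.
Proof.
by move=> h1 h2; rewrite /clamp (min_idPl (le_trans h2 h1)) (max_idPl h2).
Qed.

Lemma clamp_lipschitz (R : realType) (lo hi x y : R) :
  `|clamp lo hi x - clamp lo hi y| <= `|x - y|.
Proof.
rewrite /clamp; wlog xy : x y / x <= y.
  move=> H; have [/H//|/ltW/H] := leP x y.
  by rewrite distrC [leRHS]distrC.
rewrite distrC [leRHS]distrC (ger0_norm (_ : 0 <= y - x)) ?subr_ge0//.
rewrite /Num.max /Num.min; rewrite ler_norml.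
by case: (ltP x hi) => h1; case: (ltP y hi) => h2; case: ltP => h3; case: ltP => h4;
  apply/andP; split; lra.
Qed.

Lemma continuous_clamp (R : realType) (lo hi g : R -> R) (x : R) :
  {for x, continuous lo} -> {for x, continuous hi} -> {for x, continuous g} ->
  {for x, continuous (fun t => clamp (lo t) (hi t) (g t))}.
Proof.
move=> cl ch cg; apply: (@continuous_max _ _ lo (fun t => Num.min (g t) (hi t))) => //.
exact: (@continuous_min _ _ g hi).
Qed.

(** * Comparison with sub- and supersolutions *)

Lemma ge0_limit (R : realType) (F : set_system R) (q : R -> R) (l : R) :
  ProperFilter F -> q @ F --> l -> (\forall h \near F, 0 <= q h) -> 0 <= l.
Proof.
move=> PF ql q0; rewrite leNgt; apply/negP => l0.
have /filter_ex [h [/= h1 h2]] : \forall h \near F, q h < 0 /\ 0 <= q h.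
  by apply: filterI => //; move/cvgr_lt : ql; apply.
by move: h1; rewrite ltNge h2.
Qed.

Lemma is_derive_right_deriv (R : realType) (g : R -> R) (c d : R) :
  is_derive c 1 g d -> right_deriv g c d.
Proof.
move=> [dg <-]; apply: cvg_dnbhs_at_right.
rewrite (_ : (fun h : R => _) = (fun h : R => h^-1 *: ((g \o shift c) (h *: 1) - g c))).
  exact: dg.
by apply/funext => h; rewrite /= /GRing.scale/= mulr1 (addrC c).
Qed.

Lemma is_derive_left_deriv (R : realType) (g : R -> R) (c d : R) :
  is_derive c 1 g d -> left_deriv g c d.
Proof.
move=> [dg <-]; apply: cvg_dnbhs_at_left.
rewrite (_ : (fun h : R => _) = (fun h : R => h^-1 *: ((g \o shift c) (h *: 1) - g c))).
  exact: dg.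
by apply/funext => h; rewrite /= /GRing.scale/= mulr1 (addrC c).
Qed.

(** One-sided Fermat rule at a local maximum of [p - q]. With its left counterpart it yields a
    vanishing derivative at smooth points and excludes contact at a corner of the wrong
    orientation. *)
Lemma right_deriv_le (R : realType) (p q : R -> R) (c e lp lq : R) : 0 < e ->
  (forall z, `|z - c| < e -> p z - q z <= p c - q c) ->
  right_deriv p c lp -> right_deriv q c lq -> lp <= lq.
Proof.
move=> e0 pq Dp Dq; rewrite -subr_ge0.
apply: (ge0_limit _ (cvgB Dq Dp)).
near=> h; change (0 <= h^-1 * (q (c + h) - q c) - h^-1 * (p (c + h) - p c)).
have h0 : 0 < h by near: h; exact: nbhs_right_gt.
have he : h < e by near: h; exact: nbhs_right_lt.
rewrite -mulrBr; apply: mulr_ge0; first by rewrite invr_ge0 ltW.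
have hc : `|c + h - c| < e by rewrite addrAC subrr add0r gtr0_norm.
by have := pq (c + h) hc; lra.
Unshelve. all: by end_near.
Qed.

Lemma left_deriv_ge (R : realType) (p q : R -> R) (c e lp lq : R) : 0 < e ->
  (forall z, `|z - c| < e -> p z - q z <= p c - q c) ->
  left_deriv p c lp -> left_deriv q c lq -> lq <= lp.
Proof.
move=> e0 pq Dp Dq; rewrite -subr_ge0.
apply: (ge0_limit _ (cvgB Dp Dq)).
near=> h; change (0 <= h^-1 * (p (c + h) - p c) - h^-1 * (q (c + h) - q c)).
have h0 : h < 0 by near: h; exact: nbhs_left_lt.
have he : - e < h by near: h; apply: nbhs_left_gt; rewrite oppr_lt0.
rewrite -mulrBr; apply: mulr_le0; first by rewrite invr_le0 ltW.
have hc : `|c + h - c| < e by rewrite addrAC subrr add0r ltr0_norm// ltrNl.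
by have := pq (c + h) hc; lra.
Unshelve. all: by end_near.
Qed.

(** If [d2 > 0], then [dg] is positive just to the right of its zero [c], and the mean value theorem
    makes [g] exceed [g c] there. Differentiability of [dg] at [c] alone suffices. *)
Lemma second_derivative_at_max (R : realType) (g dg : R -> R) (c e d2 : R) : 0 < e ->
  (forall z : R, `|z - c| < e -> is_derive z 1 g (dg z)) -> is_derive c 1 dg d2 ->
  (forall z, `|z - c| < e -> g z <= g c) -> dg c = 0 /\ d2 <= 0.
Proof.
move=> e0 Dg D2 gc.
have cc : `|c - c| < e by rewrite subrr normr0.
have dg0 : dg c = 0.
  have zz (z : R) : is_derive z 1 (fun=> 0 : R) (0 : R) by exact: is_derive_cst.
  have gc' z : `|z - c| < e -> g z - 0 <= g c - 0 by move=> /gc; lra.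
  apply/eqP; rewrite eq_le; apply/andP; split.
  - exact: (right_deriv_le e0 gc' (is_derive_right_deriv (Dg c cc)) (is_derive_right_deriv (zz c))).
  - exact: (left_deriv_ge e0 gc' (is_derive_left_deriv (Dg c cc)) (is_derive_left_deriv (zz c))).
split => //; rewrite leNgt; apply/negP => d20.
have /cvgr_gt/(_ _ d20) : right_deriv dg c d2 by exact: is_derive_right_deriv.
rewrite -nbhs_nearE /at_right /within/= => -[r /= r0 hr].
pose s := Num.min (r / 2) (e / 2).
have s0 : 0 < s by rewrite lt_min; apply/andP; split; lra.
have [sr se] : s <= r / 2 /\ s <= e / 2 by split; rewrite /s ge_min lexx ?orbT.
have pos z : 0 < z -> z <= s -> 0 < dg (c + z).
  move=> z0 zs; have /hr : ball_ [eta Num.Def.normr] 0 r z.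
    by rewrite /ball_/= sub0r normrN gtr0_norm//; lra.
  by rewrite dg0 subr0 => /(_ z0); rewrite pmulr_rgt0// invr_gt0.
have [| | |x] := @MVT R g dg c (c + s).
- by rewrite ltrDl.
- move=> x; rewrite in_itv/= => /andP[x1 x2]; apply: Dg; rewrite ltr_norml; apply/andP; split; lra.
- apply: continuous_in_subspaceT => x; rewrite inE/= in_itv/= => /andP[x1 x2].
  apply: (@is_derive_continuous _ _ _ (dg x)).
  by apply: Dg; rewrite ltr_norml; apply/andP; split; lra.
rewrite in_itv/= => /andP[x1 x2].
have -> : c + s - c = s by lra.
have := gc (c + s); have -> : c + s - c = s by lra.
rewrite gtr0_norm// => /(_ _) gs; have {}gs : g (c + s) <= g c by apply: gs; lra.
have : 0 < dg x * s by rewrite mulr_gt0//; have := pos (x - c); rewrite subrKC; apply; lra.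
lra.
Qed.

Lemma C2_near_derive (R : realType) (g : R -> R) (c : R) : C2_near g c ->
  exists e : R, [/\ 0 < e, forall z : R, `|z - c| < e -> is_derive z 1 g (g^`()%classic z)
    & is_derive c 1 g^`()%classic (g^`()^`()%classic c)].
Proof.
move=> [e [e0 H]]; exists e; split; first exact: e0.
  by move=> z /H [dg _]; rewrite derive1E; exact/derivableP.
have [|_ [dg _]] := H c; first by rewrite subrr normr0.
by rewrite derive1E; exact/derivableP.
Qed.

Section Comparison.
Context {R : realType}.
Variables (E1 : set R) (f G : R -> R -> R -> R) (a b : R) (u v : R -> R).
Hypotheses (ab : a <= b) (abE : forall y, a <= y <= b -> E1 y).
Hypothesis uvG : solves_on [set t | a <= t <= b] G u v.

Lemma interior_max (g : R -> R) : (forall t, a <= t <= b -> {for t, continuous g}) ->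
  g a <= 0 -> g b <= 0 -> ~ (forall t, a <= t <= b -> g t <= 0) ->
  exists c e : R, [/\ 0 < e, 0 < g c, (forall z, `|z - c| < e -> a <= z <= b)
    & forall z, `|z - c| < e -> g z <= g c].
Proof.
move=> cg ga gb ng.
have [|c] := @EVT_max R g a b ab.
  by apply: continuous_in_subspaceT => x; rewrite inE/= in_itv/=; exact: cg.
rewrite in_itv/= => hc gmax.
have gc0 : 0 < g c.
  rewrite ltNge; apply/negP => gc; apply: ng => t ht.
  by apply: (le_trans (gmax t _)) => //; rewrite in_itv.
have ac : a < c.
  rewrite lt_neqAle; move: (hc) => /andP[-> _]; rewrite andbT.
  by apply/eqP => e; rewrite -e in gc0; lra.
have cb : c < b.
  rewrite lt_neqAle; move: (hc) => /andP[_ ->]; rewrite andbT.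
  by apply/eqP => e; rewrite e in gc0; lra.
have inab z : `|z - c| < Num.min (c - a) (b - c) -> a <= z <= b.
  by rewrite lt_min !ltr_norml => /andP[/andP[? ?] /andP[? ?]]; apply/andP; split; lra.
exists c, (Num.min (c - a) (b - c)); split => //.
- by rewrite lt_min; apply/andP; split; lra.
- by move=> z /inab hz; apply: gmax; rewrite in_itv.
Qed.

(** At a positive interior maximum of [u - beta] the slopes agree, so [G] need only beat [f] at the
    slope of [beta]; then [u'' > beta''] contradicts the maximum. At a corner, the maximum would
    force the left derivative of [beta] to be at most the right one. *)
Lemma le_supersolution (beta : R -> R) :
  supersolution E1 f beta -> (forall y, E1 y -> {for y, continuous beta}) ->
  (forall t x, a <= t <= b -> beta t < x -> derivable beta t 1 ->
     f t (beta t) (beta^`()%classic t) < G t x (beta^`()%classic t)) ->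
  u a <= beta a -> u b <= beta b -> forall t, a <= t <= b -> u t <= beta t.
Proof.
move=> sup cb Gf ua ub t ht; rewrite -subr_le0; move: t ht; apply: contrapT => H.
have cg t : a <= t <= b -> {for t, continuous (fun t => u t - beta t)}.
  move=> ht; apply: cvgB; last exact: cb (abE ht).
  exact: is_derive_continuous (uvG ht).1.
have [||c [e [e0 gc ez gmax]]] := interior_max cg _ _ H; rewrite ?subr_le0//.
have hc : a <= c <= b by apply: ez; rewrite subrr normr0.
have [[C2 ineq]|[lm [lp [Dm [Dp lt]]]]] := sup c (abE hc).
- have [r [r0 Db Db2]] := C2_near_derive C2.
  have [||||dg0 d2] := @second_derivative_at_max R (fun t => u t - beta t)
     (fun t => v t - beta^`()%classic t) c (Num.min e r)
     (G c (u c) (v c) - beta^`()^`()%classic c).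
  + by rewrite lt_min e0.
  + move=> z; rewrite lt_min => /andP[/ez/uvG[Du _] /Db]; exact: is_deriveBf.
  + by apply: is_deriveBf => //; exact: (uvG hc).2.
  + by move=> z; rewrite lt_min => /andP[/gmax].
  have bc : is_derive c 1 beta (beta^`()%classic c) by apply: Db; rewrite subrr normr0.
  have := Gf c (u c) hc; have -> : beta^`()%classic c = v c by lra.
  have -> : beta c < u c by lra.
  move=> /(_ isT (@ex_derive _ _ _ _ _ _ _ bc)).
  have e1 : beta^`()%classic c = v c by lra.
  rewrite e1 in ineq; lra.
- have Du := (uvG hc).1.
  have := right_deriv_le e0 gmax (is_derive_right_deriv Du) Dp.
  have := left_deriv_ge e0 gmax (is_derive_left_deriv Du) Dm; lra.
Qed.

Lemma ge_subsolution (alpha : R -> R) :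
  subsolution E1 f alpha -> (forall y, E1 y -> {for y, continuous alpha}) ->
  (forall t x, a <= t <= b -> x < alpha t -> derivable alpha t 1 ->
     G t x (alpha^`()%classic t) < f t (alpha t) (alpha^`()%classic t)) ->
  alpha a <= u a -> alpha b <= u b -> forall t, a <= t <= b -> alpha t <= u t.
Proof.
move=> sub ca Gf ua ub t ht; rewrite -subr_le0; move: t ht; apply: contrapT => H.
have cg t : a <= t <= b -> {for t, continuous (fun t => alpha t - u t)}.
  move=> ht; apply: cvgB; first exact: ca (abE ht).
  exact: is_derive_continuous (uvG ht).1.
have [||c [e [e0 gc ez gmax]]] := interior_max cg _ _ H; rewrite ?subr_le0//.
have hc : a <= c <= b by apply: ez; rewrite subrr normr0.
have [[C2 ineq]|[lm [lp [Dm [Dp lt]]]]] := sub c (abE hc).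
- have [r [r0 Da Da2]] := C2_near_derive C2.
  have [||||dg0 d2] := @second_derivative_at_max R (fun t => alpha t - u t)
     (fun t => alpha^`()%classic t - v t) c (Num.min e r)
     (alpha^`()^`()%classic c - G c (u c) (v c)).
  + by rewrite lt_min e0.
  + move=> z; rewrite lt_min => /andP[/ez/uvG[Du _] /Da Da']; exact: is_deriveBf.
  + by apply: is_deriveBf => //; exact: (uvG hc).2.
  + by move=> z; rewrite lt_min => /andP[/gmax].
  have ac : is_derive c 1 alpha (alpha^`()%classic c) by apply: Da; rewrite subrr normr0.
  have := Gf c (u c) hc; have e1 : alpha^`()%classic c = v c by lra.
  rewrite e1; have -> : u c < alpha c by lra.
  move=> /(_ isT (@ex_derive _ _ _ _ _ _ _ ac)).
  rewrite e1 in ineq; lra.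
- have Du := (uvG hc).1.
  have := right_deriv_le e0 gmax Dp (is_derive_right_deriv Du).
  have := left_deriv_ge e0 gmax Dm (is_derive_left_deriv Du); lra.
Qed.

End Comparison.

(** * The Nagumo bound *)

(** [s] is the supremum of the times at which [v <= c]. *)
Lemma last_crossing (R : realType) (v : R -> R) (s0 s1 c : R) : s0 <= s1 ->
  (forall t, s0 <= t <= s1 -> {for t, continuous v}) -> v s0 <= c <= v s1 ->
  exists s, [/\ s0 <= s <= s1, v s = c & forall t, s <= t <= s1 -> c <= v t].
Proof.
move=> s01 cv /andP[v0 v1].
pose A := [set t | s0 <= t <= s1 /\ v t <= c].
have A0 : A s0 by split=> //; rewrite lexx.
have ubA : ubound A s1 by move=> t [/andP[]].
have supA : has_sup A by split; [exists s0|exists s1].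
pose s := sup A.
have s0s : s0 <= s by apply: ub_le_sup => //; exists s1.
have ss1 : s <= s1 by apply: ge_sup => //; exists s0.
have hs : s0 <= s <= s1 by rewrite s0s.
have after t : s < t -> t <= s1 -> c < v t.
  move=> st ts; rewrite ltNge; apply/negP => vt.
  have : t <= s by apply: ub_le_sup; [exists s1|split=> //; rewrite ts andbT; lra].
  lra.
have vsc : v s <= c.
  rewrite leNgt; apply/negP => cvs.
  have /cvgr_gt/(_ _ cvs) := cv s hs; rewrite -nbhs_nearE => -[r /= r0 hr].
  have [t At st] := sup_adherent r0 supA.
  have tle : t <= s by apply: ub_le_sup => //; exists s1.
  have : c < v t.
    by apply: hr; rewrite /= ger0_norm ?subr_ge0//; rewrite -/s in st; lra.
  by have := At.2; lra.
have cvs : c <= v s.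
  rewrite leNgt; apply/negP => vs.
  have /cvgr_lt/(_ _ vs) := cv s hs; rewrite -nbhs_nearE => -[r /= r0 hr].
  have ss : s < s1.
    by rewrite lt_neqAle ss1 andbT; apply/eqP => e; rewrite e in vs; lra.
  pose t := Num.min s1 (s + r / 2).
  have st : s < t by rewrite /t lt_min ss; lra.
  have ts : t <= s1 by rewrite /t ge_min lexx.
  have tr : t <= s + r / 2 by rewrite /t ge_min lexx orbT.
  have : v t < c by apply: hr; rewrite /= distrC gtr0_norm ?subr_gt0//; lra.
  have := after t st ts; lra.
exists s; split => //; first by apply/eqP; rewrite eq_le vsc.
move=> t /andP[]; rewrite le_eqVlt => /orP[/eqP <- //|st ts].
exact/ltW/after.
Qed.

(** Reversing time and changing the sign of [v] turns a first upward crossing into a last one. *)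
Lemma first_crossing (R : realType) (v : R -> R) (s0 s1 c : R) : s0 <= s1 ->
  (forall t, s0 <= t <= s1 -> {for t, continuous v}) -> v s0 <= c <= v s1 ->
  exists s, [/\ s0 <= s <= s1, v s = c & forall t, s0 <= t <= s -> v t <= c].
Proof.
move=> s01 cv /andP[v0 v1].
have [|t ht| |s [hs vs H]] := @last_crossing R (fun t => - v (- t)) (- s1) (- s0) (- c).
- by rewrite lerN2.
- have ht' : s0 <= - t <= s1 by lra.
  apply: (@continuousN _ _ _ (fun t => v (- t))).
  apply: (@continuous_comp _ _ _ (fun t : R => - t) v); last exact: cv.
  exact: opp_continuous.
- by rewrite !opprK !lerN2 v1 v0.
exists (- s); split; first by lra.
- by apply: oppr_inj.
- move=> t ht; have h : s <= - t <= - s0 by lra.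
  by have := H _ h; rewrite opprK lerN2.
Qed.

(* Between the last time [v = n] and the next time [v = n + 1], the speed [v']
   is at most [p n], so at least [1 / p n] time elapses, during which [u] grows
   at rate at least [n]. *)
Lemma nagumo_gain (R : realType) (u v dv : R -> R) (p : nat -> R) (N0 : nat) (s0 s1 : R) (n : nat) :
  (forall k, 0 < p k) -> (N0 <= n)%N -> s0 <= s1 ->
  (forall t : R, s0 <= t <= s1 -> is_derive t 1 u (v t) /\ is_derive t 1 v (dv t)) ->
  (forall t k, s0 <= t <= s1 -> (N0 <= k < n)%N -> k%:R <= v t <= k.+1%:R -> dv t <= p k) ->
  (forall t, s0 <= t <= s1 -> N0%:R <= v t) -> v s0 <= N0%:R -> n%:R <= v s1 ->
  \sum_(N0 <= k < n) k%:R / p k <= u s1 - u s0.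
Proof.
move=> p0 + s01 D dvp vN0 vs0.
have mono x y : s0 <= x -> x <= y -> y <= s1 -> u x <= u y.
  move=> sx xy ys; apply: (@is_derive_ge0_le _ _ v _ _ xy) => t ht.
    by apply: (D t _).1; lra.
  have : N0%:R <= v t by apply: vN0; lra.
  by apply: le_trans.
have cv t : s0 <= t <= s1 -> {for t, continuous v}.
  by move=> ht; exact: is_derive_continuous (D t ht).2.
(* The claim is made for every time [t] at which the level is exceeded, so that the induction
   hypothesis can be used at the crossing time [x]. *)
suff H m : (N0 + m <= n)%N -> forall t, s0 <= t <= s1 -> (N0 + m)%:R <= v t ->
    \sum_(N0 <= k < N0 + m) k%:R / p k <= u t - u s0.
  move=> Nn nv; have := H (n - N0)%N; rewrite subnKC// leqnn => /(_ isT s1); apply => //; lra.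
elim: m => [_ t ht _|m IH mn t ht vt].
  by rewrite addn0 big_geq// subr_ge0; apply: mono; lra.
rewrite addnS big_nat_recr ?leq_addr//=; set n' := (N0 + m)%N in IH vt *.
rewrite addnS -/n' in vt mn.
have n'S : n'.+1%:R = n'%:R + 1 :> R by rewrite -addn1 natrD.
have N0n : N0%:R <= n'%:R :> R by rewrite ler_nat leq_addr.
have [|r hr| |x [hx vx xge]] := @last_crossing R v s0 t n'%:R.
- by lra.
- by apply: cv; lra.
- by apply/andP; split; lra.
have [|r hr| |y [hy vy yle]] := @first_crossing R v x t n'.+1%:R.
- by lra.
- by apply: cv; lra.
- by rewrite vx n'S; apply/andP; split; lra.
have xy : x <= y by lra.
have h1 : \sum_(N0 <= k < n') k%:R / p k <= u x - u s0.
  by apply: IH; [exact: ltnW|lra|rewrite vx].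
have h2 : p n' * x - v x <= p n' * y - v y.
  apply: (@is_derive_ge0_le _ (fun t => p n' * t - v t) (fun t => p n' - dv t) _ _ xy) => r hr.
    by apply: is_deriveBf; [exact: is_derive_scale|apply: (D r _).2; lra].
  rewrite subr_ge0; apply: dvp; rewrite ?leq_addr ?mn//; first by lra.
  by apply/andP; split; [apply: xge; lra|apply: yle; lra].
have h3 : u x - n'%:R * x <= u y - n'%:R * y.
  apply: (@is_derive_ge0_le _ (fun t => u t - n'%:R * t) (fun t => v t - n'%:R) _ _ xy) => r hr.
    by apply: is_deriveBf; [apply: (D r _).1; lra|exact: is_derive_scale].
  by rewrite subr_ge0; apply: xge; lra.
have h4 : u y <= u t by apply: mono; lra.
have h5 : n'%:R / p n' <= n'%:R * (y - x).
  rewrite vx vy n'S in h2; apply: ler_wpM2l => //.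
  by rewrite -[leLHS]mul1r ler_pdivrMr//; lra.
lra.
Qed.

(** If [v t1] exceeded [N], then after the last crossing of the level [N0] the function [u] would
    gain the whole sum, which is more than its admissible growth [D]. *)
Lemma nagumo_upper (R : realType) (u v dv : R -> R) (p : nat -> R) (N0 N : nat) (D t0 t1 : R) :
  (forall k, 0 < p k) -> (N0 <= N)%N -> t0 <= t1 ->
  (forall t : R, t0 <= t <= t1 -> is_derive t 1 u (v t) /\ is_derive t 1 v (dv t)) ->
  (forall t k, t0 <= t <= t1 -> (N0 <= k < N)%N -> k%:R <= v t <= k.+1%:R -> dv t <= p k) ->
  (forall t, t0 <= t <= t1 -> u t1 - u t <= D) ->
  v t0 <= N0%:R -> D < \sum_(N0 <= k < N) k%:R / p k -> v t1 <= N%:R.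
Proof.
move=> p0 N0N t01 H dvp uD v0 DS; rewrite leNgt; apply/negP => vN.
have N0N' : N0%:R <= N%:R :> R by rewrite ler_nat.
have [//|t ht||s [hs vs sge]] := @last_crossing R v t0 t1 N0%:R.
- exact: is_derive_continuous (H t ht).2.
- by rewrite v0/=; lra.
have st1 : s <= t1 by lra.
have := @nagumo_gain R u v dv p N0 s t1 N p0 N0N st1.
have := uD s hs; move=> h1 h2.
suff : \sum_(N0 <= k < N) k%:R / p k <= u t1 - u s by lra.
apply: h2 => //; rewrite ?vs//; try lra.
- by move=> t ht; apply: H; lra.
- by move=> t k ht; apply: dvp; lra.
Qed.

(** [nagumo_upper] bounds a slope from above and forward in time; applied to [u], to [- u] and to
    their time reflections, it yields both signs on both sides of [t0]. *)
Lemma nagumo_bound (R : realType) (u v dv : R -> R) (p : nat -> R) (N0 N : nat) (D a b t0 : R) :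
  (forall k, 0 < p k) -> (N0 <= N)%N -> a <= t0 <= b ->
  (forall t : R, a <= t <= b -> is_derive t 1 u (v t) /\ is_derive t 1 v (dv t)) ->
  (forall t k, a <= t <= b -> (N0 <= k < N)%N -> k%:R <= `|v t| <= k.+1%:R -> `|dv t| <= p k) ->
  (forall s t, a <= s <= b -> a <= t <= b -> u s - u t <= D) ->
  `|v t0| <= N0%:R -> D < \sum_(N0 <= k < N) k%:R / p k ->
  forall t, a <= t <= b -> `|v t| <= N%:R.
Proof.
move=> p0 N0N h0 H dvp uD v0 DS.
have pos r k : a <= r <= b -> (N0 <= k < N)%N -> k%:R <= v r <= k.+1%:R -> dv r <= p k /\ - dv r <= p k.
  move=> hr Nk hk; have v0' : 0 <= v r by apply: le_trans (andP hk).1.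
  by have := dvp r k hr Nk; rewrite ger0_norm// => /(_ hk); rewrite ler_norml => /andP[]; lra.
have neg r k : a <= r <= b -> (N0 <= k < N)%N -> k%:R <= - v r <= k.+1%:R -> dv r <= p k /\ - dv r <= p k.
  move=> hr Nk hk; have v0' : 0 <= - v r by apply: le_trans (andP hk).1.
  by have := dvp r k hr Nk; rewrite -normrN ger0_norm// => /(_ hk); rewrite ler_norml => /andP[]; lra.
have [v1 v2] : v t0 <= N0%:R /\ - v t0 <= N0%:R by move: v0; rewrite ler_norml => /andP[]; lra.
have HN (r : R) : a <= - r <= b -> is_derive r 1 (fun t => u (- t)) (- v (- r)) /\
    is_derive r 1 (fun t => v (- t)) (- dv (- r)).
  by move=> hr; have [Du Dv] := H _ hr; split; apply: is_derive_compN.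
move=> t ht; rewrite ler_norml lerNl; apply/andP.
have [t0t|/ltW tt0] := leP t0 t; split.
- apply: (@nagumo_upper R (fun t => - u t) (fun t => - v t) (fun t => - dv t) p N0 N D t0 t) => //.
  + move=> r hr; have [|Du Dv] := H r; first lra.
    by split; exact: is_deriveNf.
  + by move=> r k hr Nk hk; apply: (neg r k _ Nk hk).2; lra.
  + by move=> r hr; have := uD r t; lra.
- apply: (@nagumo_upper R u v dv p N0 N D t0 t) => //.
  + by move=> r hr; apply: H; lra.
  + by move=> r k hr Nk hk; apply: (pos r k _ Nk hk).1; lra.
  + by move=> r hr; have := uD t r; lra.
- have := @nagumo_upper R (fun t => u (- t)) (fun t => - v (- t)) (fun t => dv (- t)) p N0 N D (- t0) (- t).
  rewrite !opprK; apply => //; first lra.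
  + move=> r hr; have [|Du Dv] := HN r; first lra.
    by split => //; rewrite -[dv _]opprK; exact: is_deriveNf.
  + by move=> r k hr Nk hk; apply: (neg (- r) k _ Nk hk).1; lra.
  + by move=> r hr; apply: uD; lra.
- have := @nagumo_upper R (fun t => - u (- t)) (fun t => v (- t)) (fun t => - dv (- t)) p N0 N D (- t0) (- t).
  rewrite !opprK; apply => //; first lra.
  + move=> r hr; have [|Du Dv] := HN r; first lra.
    by split => //; rewrite -[v _]opprK; exact: is_deriveNf.
  + by move=> r k hr Nk hk; apply: (pos (- r) k _ Nk hk).2; lra.
  + by move=> r hr; have := uD (- r) t; lra.
Qed.

(** The function [phi] of the Nagumo condition is arbitrary, so the integrand may fail to be
    measurable. The integral of a nonnegative function is a supremum over simple functions below it,
    hence monotone regardless. *)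
Lemma ge0_le_integral_nonmeasurable d (T : measurableType d) (R : realType)
    (mu : {measure set T -> \bar R}) (D : set T) (g h : T -> \bar R) :
  (forall x, D x -> (0 <= g x)%E) -> (forall x, D x -> (g x <= h x)%E) ->
  (\int[mu]_(x in D) g x <= \int[mu]_(x in D) h x)%E.
Proof.
move=> g0 gh.
rewrite !ge0_integralE//; last by move=> x Dx; apply: le_trans (gh x Dx); exact: g0.
apply: ereal_sup_le => _ [k hk <-]; exists k => //= x.
apply: (le_trans (hk x)); rewrite /patch; case: ifPn => //; rewrite inE; exact: gh.
Qed.

(** The comparison half of the integral test: [g] lies below a step function with value [w k] on
    [[k, k + 1[], which is measurable and is integrated term by term. *)
Lemma integral_le_step (R : realType) (g : R -> \bar R) (w : nat -> R) (m : nat) (B : R) :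
  (forall k, 0 <= w k) ->
  (forall s : R, m%:R <= s -> (0 <= g s)%E) ->
  (forall (k : nat) (s : R), (m <= k)%N -> k%:R <= s < k.+1%:R -> (g s <= (w k)%:E)%E) ->
  (forall N, \sum_(m <= k < N) w k <= B) ->
  (\int[lebesgue_measure]_(s in `[m%:R : R, +oo[%classic) g s <= B%:E)%E.
Proof.
move=> w0 g0 gw wB.
pose w' k := if (m <= k)%N then w k else 0.
have w'0 k : 0 <= w' k by rewrite /w'; case: ifP.
have w'B N : \sum_(0 <= k < N) w' k <= B.
  have [mN|/ltnW Nm] := leqP m N.
    rewrite (big_cat_nat _ mN)//= big_nat_cond big1 ?add0r.
      rewrite (eq_big_nat _ _ (F2 := w)) // => k /andP[mk _]; by rewrite /w' mk.
    by move=> k /andP[/andP[_ km] _]; rewrite /w' leqNgt km.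
  rewrite big_nat_cond big1; last first.
    by move=> k /andP[/andP[_ km] _]; rewrite /w' leqNgt (leq_trans km Nm).
  by have := wB m; rewrite big_geq.
pose J k := `[k%:R, k.+1%:R[%classic : set R.
pose h k (s : measurableTypeR R) : \bar R := ((w' k)%:E * (\1_(J k) s)%:E)%E.
have h0 k s : (0 <= h k s)%E by rewrite /h mule_ge0// lee_fin.
have mI k (D : set (measurableTypeR R)) : measurable_fun D (fun s => (\1_(J k) s : R)%:E).
  by apply/measurable_EFinP/measurable_indic; exact: measurable_itv.
have mh k (D : set (measurableTypeR R)) : measurable_fun D (h k).
  exact: measurable_funeM.
apply: (@le_trans _ _ (\int[lebesgue_measure]_(s in `[m%:R : R, +oo[) (\sum_(0 <= k <oo) h k s))%E).
  apply: ge0_le_integral_nonmeasurable => s; rewrite /= in_itv/= andbT => ms; first exact: g0.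
  have s0 : 0 <= s by apply: le_trans ms.
  pose k := Num.truncn s.
  have hk : k%:R <= s < k.+1%:R by exact: truncn_itv.
  have mk : (m <= k)%N by rewrite truncn_ge_nat.
  apply: (le_trans (gw k s mk hk)).
  apply: le_trans (nneseries_lim_ge k.+1 _) => //.
  rewrite big_nat_recr//= /h /w' mk indicE mem_set ?mule1; last by rewrite /J/= in_itv.
  by apply: leeDr; apply: sume_ge0 => i _; exact: h0.
rewrite integral_nneseries//.
apply: lime_le; first by apply: is_cvg_nneseries => k _ _; apply: integral_ge0.
apply: nearW => N; apply: (@le_trans _ _ (\sum_(0 <= k < N) (w' k)%:E)%E); last first.
  by rewrite sumEFin lee_fin.
apply: lee_sum => k _; rewrite /h (ge0_integralZl _ _ (mI k _)) ?lee_fin//.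
rewrite integral_indic//; try exact: measurable_itv.
rewrite -[leRHS]mule1; apply: lee_wpmul2l; first by rewrite lee_fin.
apply: (@le_trans _ _ (lebesgue_measure (J k))).
  by apply: le_measure; rewrite ?inE; [apply: measurableI| |exact: subIsetl]; exact: measurable_itv.
rewrite lebesgue_measure_itv/= lte_fin ltr_nat ltnSn -EFinB lee_fin.
by rewrite -natrB// subSnn.
Qed.

(* Applied with [C = |v|], the clause of the Nagumo condition about [fC] bounds
   [f y u v] by [phi s] for every [s >= |v|], so [phi] may be replaced by its
   infimum over unit intervals.  The infimum is shifted by [1] to be positive;
   if [f] vanishes for all [v != 0] the infimum may be [0], whence the case
   distinction. *)
Lemma nagumo_weights (R : realType) (f : R -> R -> R -> R) (K : set (R * R)) (phi : R -> R) :
  K !=set0 ->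
  (forall r : R, 0 < r ->
    (\int[lebesgue_measure]_(s in `[r, +oo[%classic) ((s%:E) * ((phi s)%:E)^-1))%E = +oo%E) ->
  (forall p, K p -> forall v : R, `|f p.1 p.2 v| <= phi `|v| /\
       (forall C : R, 0 < C -> `|fC f C p.1 p.2 v| <= phi `|v|)) ->
  exists p : nat -> R, [/\ forall k, 0 < p k,
    forall k q v, K q -> (0 < k)%N -> k%:R <= `|v| <= k.+1%:R -> `|f q.1 q.2 v| <= p k
    & forall N0 B, (0 < N0)%N -> exists N, (N0 <= N)%N /\ B < \sum_(N0 <= k < N) k%:R / p k].
Proof.
move=> [q0 Kq0] int fphi.
have fle q v s : K q -> v != 0 -> `|v| <= s -> `|f q.1 q.2 v| <= phi s.
  move=> Kq v0 vs; have va : 0 < `|v| by rewrite normr_gt0.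
  have s0 : 0 <= s by apply: le_trans vs.
  have [v1|v1] := leP 0 v.
  - have := (fphi q Kq s).2 _ va; rewrite (ger0_norm s0) /fC (min_idPr vs).
    by rewrite (max_idPr _) ?ge0_cp ?(ger0_norm v1)//; lra.
  - have := (fphi q Kq (- s)).2 _ va; rewrite normrN (ger0_norm s0) /fC.
    rewrite (min_idPl _); last by lra.
    by rewrite (max_idPl _) ?lerN2// (ltr0_norm v1) opprK.
have [triv|] := pselect (forall q v, K q -> v != 0 -> f q.1 q.2 v = 0).
  exists (fun=> 1); split => //.
  - move=> k q v Kq k0 /andP[kv _]; rewrite triv// ?normr0//.
    by rewrite -normr_gt0 (lt_le_trans _ kv)// ltr0n.
  - move=> N0 B N00; exists (N0 + (Num.truncn B).+1)%N; split; first exact: leq_addr.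
    apply: (lt_le_trans (truncnS_gt B)).
    apply: (@le_trans _ _ (\sum_(N0 <= k < N0 + (Num.truncn B).+1) 1)).
      by rewrite big_const_nat addKn iter_addr_0.
    apply: ler_sum_nat => k /andP[Nk _]; rewrite divr1.
    by rewrite -[1]/(1%:R) ler_nat; exact: leq_trans Nk.
move=> /existsNP[q1 /existsNP[v1 /not_implyP[Kq1 /not_implyP[v10 /eqP f1]]]].
pose c := `|f q1.1 q1.2 v1|; have c0 : 0 < c by rewrite normr_gt0.
(* The infimum is over [[k + 1, k + 2]], not [[k, k + 1]]: all its points are at least [|v|] when
   [|v| <= k + 1], as [fle] requires. *)
pose q k := inf (phi @` `[k.+1%:R, k.+2%:R]).
have lbq k x : (forall s, k.+1%:R <= s <= k.+2%:R -> x <= phi s) -> x <= q k.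
  move=> H; apply: lb_le_inf.
    by exists (phi k.+1%:R), k.+1%:R => //=; rewrite in_itv/= lexx ler_nat leqnSn.
  by move=> _ [s /= hs <-]; apply: H; rewrite in_itv/= in hs.
have qphi k s : k.+1%:R <= s <= k.+2%:R -> q k <= phi s.
  move=> hs; apply: ge_inf; last by exists s => //=; rewrite in_itv.
  exists 0 => _ [t /= ht <-]; rewrite in_itv/= in ht.
  have t0 : 0 <= t by apply: le_trans (andP ht).1.
  by have := (fphi q0 Kq0 t).1; rewrite (ger0_norm t0); apply: le_trans.
have qf k r v : K r -> v != 0 -> `|v| <= k.+1%:R -> `|f r.1 r.2 v| <= q k.
  move=> Kr v0 vk; apply: lbq => s /andP[ks _]; apply: fle => //; exact: le_trans ks.
have q_ge0 k : 0 <= q k.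
  apply: lbq => s /andP[ks _]; have s0 : 0 <= s by apply: le_trans ks.
  by have := (fphi q0 Kq0 s).1; rewrite (ger0_norm s0); apply: le_trans.
have q1S k : 0 < q k + 1 by have := q_ge0 k; lra.
exists (fun k => q k + 1); split => //.
  move=> k r v Kr k0 /andP[kv vk]; apply: (@le_trans _ _ (q k)); last lra.
  by apply: qf => //; rewrite -normr_gt0 (lt_le_trans _ kv)// ltr0n.
move=> N0 B N00; apply: contrapT => H.
have HB N : (N0 <= N)%N -> \sum_(N0 <= k < N) k%:R / (q k + 1) <= B.
  by move=> N0N; rewrite leNgt; apply/negP => BN; apply: H; exists N.
(* From [m] on, levels exceed [|v1|], so that [q k >= c > 0] and the shift by [1] costs only a
   constant factor. *)
pose m := maxn N0 (Num.truncn `|v1|).+1.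
have N0m : (N0 <= m)%N by exact: leq_maxl.
have t0 k : 0 <= k%:R / (q k + 1) by rewrite divr_ge0// ltW.
have cq k : (m <= k)%N -> c <= q k.
  move=> mk; apply: qf => //; apply: ltW; apply: (lt_le_trans (truncnS_gt _)).
  by rewrite ler_nat ltnS; apply: leq_trans mk; apply: leq_trans (leq_maxr _ _); exact: leqnSn.
(* On [[k + 1, k + 2[] one has [s <= 3 * k], and [q k + 1 <= (1 + c^-1) * phi s]. *)
pose D := 3 * (1 + c^-1).
have ci : 0 < c^-1 by rewrite invr_gt0.
have D0 : 0 <= D by rewrite /D; lra.
have : (\int[lebesgue_measure]_(s in `[m.+1%:R : R, +oo[%classic)
    ((s%:E) * ((phi s)%:E)^-1) <= (D * B)%:E)%E.
  (* The predecessor undoes the shift in [q]: on [[k, k + 1[] the lower bound for [phi] is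
     [q k.-1]. *)
  apply: (@integral_le_step R _ (fun k => D * (k.-1%:R / (q k.-1 + 1)))).
  - by move=> k; rewrite mulr_ge0.
  - move=> s ms; have s0 : 0 <= s by apply: le_trans ms.
    apply: mule_ge0; first by rewrite lee_fin.
    rewrite inve_ge0 lee_fin.
    by have := (fphi q0 Kq0 s).1; rewrite (ger0_norm s0); apply: le_trans.
  - move=> [//|k] s mk /andP[ks sk]; rewrite ltnS in mk => /=.
    have qs : q k <= phi s by apply: qphi; rewrite ks ltW.
    have cqk := cq k mk.
    have p0 : 0 < phi s by lra.
    rewrite inver gt_eqF// -EFinM lee_fin ler_pdivrMr//.
    have k1 : 1 <= k%:R :> R.
      by rewrite -[1]/(1%:R) ler_nat; apply: leq_trans mk; exact: leq_trans N0m.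
    have e2 : k.+2%:R = k%:R + 2 :> R by rewrite -addn2 natrD.
    have h1 : s <= 3 * k%:R by rewrite e2 in sk; lra.
    have h2 : q k + 1 <= (1 + c^-1) * phi s.
      have : 1 <= c^-1 * phi s by rewrite mulrC ler_pdivlMr//; lra.
      lra.
    apply: (le_trans h1).
    have -> : D * (k%:R / (q k + 1)) * phi s = 3 * k%:R * ((1 + c^-1) * phi s / (q k + 1)).
      by rewrite /D; ring.
    rewrite -[leLHS]mulr1; apply: ler_wpM2l; first lra.
    by rewrite ler_pdivlMr// mul1r.
  - move=> [|N]; first by rewrite big_geq//; rewrite mulr_ge0//; have := HB N0; rewrite big_geq//; apply.
    rewrite big_add1/= -mulr_sumr; apply: ler_wpM2l => //.
    have [mN|Nm] := leqP m N; last first.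
      by rewrite big_geq; [have := HB N0; rewrite big_geq//; apply|exact: ltnW].
    apply: le_trans (HB N (leq_trans N0m mN)).
    by rewrite [leRHS](big_cat_nat N0m mN)/= lerDr sumr_ge0.
by rewrite int ?ltr0n//.
Qed.

(** * The local problem *)

Definition lipschitz3 (R : realType) (L : R) (F : R -> R -> R -> R) : Prop :=
  forall t u v t' u' v', `|F t u v - F t' u' v'| <= L * (`|t - t'| + `|u - u'| + `|v - v'|).

Lemma lipschitz3_nemytskii (R : realType) (L : R) (F : R -> R -> R -> R) :
  lipschitz3 L F -> nemytskii_continuous F.
Proof.
move=> LF u v cu cv x; apply/cvgrPdist_le => e e0.
have C0 : 0 < 3 * (`|L| + 1) by have := normr_ge0 L; lra.
have d0 : 0 < e / (3 * (`|L| + 1)) by rewrite divr_gt0.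
near=> y; apply: (le_trans (LF _ _ _ _ _ _)).
have h1 : `|x - y| <= e / (3 * (`|L| + 1)).
  by near: y; apply: (@cvgr_dist_le _ _ _ _ _ id x).
have h2 : `|u x - u y| <= e / (3 * (`|L| + 1)).
  by near: y; move/cvgrPdist_le : (cu x); apply.
have h3 : `|v x - v y| <= e / (3 * (`|L| + 1)).
  by near: y; move/cvgrPdist_le : (cv x); apply.
set S := _ + _ + _; have S0 : 0 <= S by rewrite /S !addr_ge0.
have SL : S * (`|L| + 1) <= e.
  rewrite -ler_pdivlMr; last by have := normr_ge0 L; lra.
  have -> : e / (`|L| + 1) = 3 * (e / (3 * (`|L| + 1))) by field; rewrite gt_eqF//; have := normr_ge0 L; lra.
  by rewrite /S; lra.
have := ler_wpM2r S0 (ler_norm L); lra.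
Unshelve. all: by end_near.
Qed.

Lemma convex_open_interval (R : realType) (E : set R) (x y z : R) :
  open_interval E -> E x -> E y -> x <= z <= y -> E z.
Proof.
move=> [A [B [_ ->]]] /= [Ax _] [_ yB] /andP[xz zy]; split.
- by apply: (lt_le_trans Ax); rewrite lee_fin.
- by apply: le_lt_trans yB; rewrite lee_fin.
Qed.

(** This difference is the penalty for leaving the strip; its bound keeps the penalised right-hand
    side bounded. *)
Lemma clamp_widen_dist (R : realType) (lo hi x : R) : lo <= hi ->
  `|clamp (lo - 1) (hi + 1) x - clamp lo hi x| <= 1.
Proof.
move=> lh; rewrite /clamp /Num.max /Num.min ler_norml.
by case: (ltP x hi) => h1; case: (ltP x (hi + 1)) => h2; case: ltP => h3; case: ltP => h4;
  apply/andP; split; lra.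
Qed.

Section LocalProblem.
Context {R : realType}.
Variables (E1 E2 E2t : set R) (f : R -> R -> R -> R) (alpha beta : R -> R).
Hypotheses (oE2 : open_interval E2) (E2E2t : E2 `<=` E2t).
Hypothesis lipf : loc_lipschitz_on3 (fun y u => E1 y /\ E2 u) f.
Hypothesis nagf : nagumo E1 E2t f.
Hypotheses (ca : cont_into E1 E2 alpha) (cb : cont_into E1 E2 beta).
Hypotheses (Xa : classX E1 E2t alpha) (Xb : classX E1 E2t beta).
Hypothesis ab : forall y, E1 y -> alpha y <= beta y.
Hypotheses (suba : subsolution E1 f alpha) (supb : supersolution E1 f beta).

Definition between (a b : R) (u : R -> R) : Prop :=
  forall t, a <= t <= b -> alpha t <= u t <= beta t.

Definition slope_bounded (a b N : R) (v : R -> R) : Prop :=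
  forall t : R, a <= t <= b -> `|v t| <= N.

(** The last clause assumes the equation only while [|v| <= N], since the Nagumo estimate looks only
    at levels below [N]. It therefore applies both to [f] and to any equation that modifies [f]
    beyond slope [N]. *)
Lemma apriori_bounds (a b : R) : a < b -> (forall y, a <= y <= b -> E1 y) ->
  exists m M N : R,
  [/\ 0 <= N, forall t, a <= t <= b -> m <= alpha t /\ beta t <= M,
    forall y u, a <= y <= b -> m <= u <= M -> E1 y /\ E2 u,
    forall t, a <= t <= b ->
      (derivable alpha t 1 -> `|alpha^`()%classic t| <= N) /\
      (derivable beta t 1 -> `|beta^`()%classic t| <= N)
  & forall u v dv : R -> R,
     (forall t : R, a <= t <= b -> is_derive t 1 u (v t) /\ is_derive t 1 v (dv t)) ->
     (forall t, a <= t <= b -> m <= u t <= M) ->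
     (forall t, a <= t <= b -> `|v t| <= N -> dv t = f t (u t) (v t)) ->
     forall t, a <= t <= b -> `|v t| <= N].
Proof.
move=> ltab abE.
have leab : a <= b by exact: ltW.
have cta t : a <= t <= b -> {for t, continuous alpha} by move=> /abE /ca[].
have ctb t : a <= t <= b -> {for t, continuous beta} by move=> /abE /cb[].
have [|c1 hc1 amin] := @EVT_min R alpha a b leab.
  by apply: continuous_in_subspaceT => x; rewrite inE/= in_itv/=; exact: cta.
have [|c2 hc2 bmax] := @EVT_max R beta a b leab.
  by apply: continuous_in_subspaceT => x; rewrite inE/= in_itv/=; exact: ctb.
rewrite in_itv/= in hc1; rewrite in_itv/= in hc2.
set m := alpha c1 in amin; set M := beta c2 in bmax.
have bounds t : a <= t <= b -> m <= alpha t /\ beta t <= M.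
  by move=> ht; split; [apply: amin|apply: bmax]; rewrite in_itv.
have E2m : E2 m by exact: (ca (abE _ hc1)).1.
have E2M : E2 M by exact: (cb (abE _ hc2)).1.
have haa : a <= a <= b by rewrite lexx.
have mM : m <= M by have [? ?] := bounds a haa; have := ab (abE a haa); lra.
have inE12 y u : a <= y <= b -> m <= u <= M -> E1 y /\ E2 u.
  by move=> hy hu; split; [exact: abE|exact: convex_open_interval hu].
pose K : set (R * R) := `[a, b]%classic `*` `[m, M]%classic.
have cK : compact K by apply: compact_setX; exact: segment_compact.
have Kin y u : a <= y <= b -> m <= u <= M -> K (y, u).
  by move=> ? ?; split; rewrite /= in_itv.
have KE : K `<=` [set p | E1 p.1 /\ E2t p.2].
  move=> [y u] [/=]; rewrite !in_itv/= => hy hu.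
  by have [? /E2E2t] := inE12 _ _ hy hu.
have [phi [int fphi]] := nagf cK KE.
have K0 : K !=set0 by exists (a, m); apply: Kin; rewrite lexx.
have [p [p0 fp div]] := nagumo_weights K0 int fphi.
have [Ma hMa] := Xa.2 _ (@segment_compact R a b) (fun y hy => abE y hy).
have [Mb hMb] := Xb.2 _ (@segment_compact R a b) (fun y hy => abE y hy).
pose D := M - m.
(* Above [D / (b - a)], so that the mean value theorem supplies a time [t0] of slope at most [N0];
   above [Ma] and [Mb], so that the slopes of [alpha] and [beta] escape the cut-off. *)
pose N0 := (Num.truncn (D / (b - a) + `|Ma| + `|Mb|)).+1.
have Db0 : 0 <= D / (b - a) by rewrite divr_ge0 ?subr_ge0.
have N0b : D / (b - a) + `|Ma| + `|Mb| < N0%:R by exact: truncnS_gt.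
have [N [N0N DS]] := div N0 D isT.
have N0N' : N0%:R <= N%:R :> R by rewrite ler_nat.
have [na nb] := (normr_ge0 Ma, normr_ge0 Mb).
exists m, M, N%:R; split => //.
- move=> t ht; split => dt.
  + have := hMa t; rewrite /= in_itv/= => /(_ ht dt); have := ler_norm Ma; lra.
  + have := hMb t; rewrite /= in_itv/= => /(_ ht dt); have := ler_norm Mb; lra.
- move=> u v dv H mu hdv.
  have [t0 ht0 vt0] : exists2 t0, a <= t0 <= b & u b - u a = v t0 * (b - a).
    have [| |t0] := @MVT_segment R u v a b leab.
    - by move=> x; rewrite in_itv/= => hx; apply: (H x _).1; lra.
    - apply: continuous_in_subspaceT => x; rewrite inE/= in_itv/= => hx.
      exact: is_derive_continuous (H x hx).1.
    by rewrite in_itv/= => ? ?; exists t0.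
  have osc s t : a <= s <= b -> a <= t <= b -> u s - u t <= D.
    by move=> /mu ? /mu ?; rewrite /D; lra.
  apply: (@nagumo_bound R u v dv p N0 N D a b t0) => //.
  + move=> t k ht /andP[Nk kN] hk.
    have vN : `|v t| <= N%:R by move/andP: hk => [_ /le_trans]; apply; rewrite ler_nat.
    rewrite (hdv t ht vN); apply: (fp k (t, u t)) => //; first by apply: Kin => //; exact: mu.
    exact: leq_trans Nk.
  + apply: (@le_trans _ _ (D / (b - a))); last lra.
    rewrite ler_pdivlMr ?subr_gt0// -[X in _ * X]ger0_norm ?subr_ge0// -normrM -vt0.
    have hbb : a <= b <= b by rewrite lexx leab.
    have := osc _ _ hbb haa; have := osc _ _ haa hbb.
    by rewrite ler_norml => ? ?; apply/andP; split; lra.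
Qed.

(* [F] is a globally Lipschitz bounded extension of [f] beyond the region where
   the solutions of interest live. *)
Definition truncation (a b N L B : R) (F : R -> R -> R -> R) : Prop :=
  [/\ 0 <= L, lipschitz2 L F, nemytskii_continuous F, forall t u v, `|F t u v| <= B &
      forall t x y, a <= t <= b -> alpha t <= x <= beta t -> `|y| <= N -> F t x y = f t x y].

(** The slope bound is stated for every solution of the original equation in the strip, because it
    will be applied to restrictions of solutions found on larger intervals. *)
Lemma local_problem (a b : R) : a < b -> (forall y, a <= y <= b -> E1 y) ->
  exists (N L B : R) (F : R -> R -> R -> R) (u v : R -> R),
  [/\ truncation a b N L B F,
    forall u v, solves_on [set t | a <= t <= b] f u v -> between a b u ->
      slope_bounded a b N v,
    solves_on [set t | a <= t <= b] f u v & between a b u].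
Proof.
move=> ltab abE.
have leab : a <= b by exact: ltW.
have [m [M [N [N0 bounds inE12 dN nag]]]] := apriori_bounds ltab abE.
have [L [L1 HL]] := rectangle_lipschitz N lipf inE12.
have haa : a <= a <= b by rewrite lexx.
have hbb : a <= b <= b by rewrite lexx leab.
have mM : m <= M by have [? ?] := bounds a haa; have := ab (abE a haa); lra.
have NN : - N <= N by lra.
pose F t u v := f (clamp a b t) (clamp m M u) (clamp (- N) N v).
have F3 : lipschitz3 L F.
  move=> t u v t' u' v'; apply: (le_trans (HL _ _ _ _ _ _ _ _ _ _ _ _)); try exact: clamp_itv.
  apply: ler_wpM2l; first by lra.
  by apply: lerD; [apply: lerD|]; exact: clamp_lipschitz.
have FE t x y : a <= t <= b -> m <= x <= M -> `|y| <= N -> F t x y = f t x y.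
  by move=> ht hx hy; rewrite /F !clamp_id// -ler_norml.
have F2 : lipschitz2 L F.
  by move=> t u v u' v'; have := F3 t u v t u' v'; rewrite subrr normr0 add0r.
have Fn : nemytskii_continuous F by exact: lipschitz3_nemytskii F3.
pose B : R := `|F 0 0 0| + L * ((b - a) + (M - m) + (N + N)).
have FB t u v : `|F t u v| <= B.
  have -> : F t u v = F 0 0 0 + (F t u v - F 0 0 0) by lra.
  apply: (le_trans (ler_normD _ _)); rewrite lerD2l.
  apply: (le_trans (HL _ _ _ _ _ _ _ _ _ _ _ _)); try exact: clamp_itv.
  have dist (lo hi x y : R) : lo <= hi -> `|clamp lo hi x - clamp lo hi y| <= hi - lo.
    move=> lh; have := clamp_itv x lh; have := clamp_itv y lh => /andP[? ?] /andP[? ?].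
    by rewrite ler_norml; apply/andP; split; lra.
  apply: ler_wpM2l; first by lra.
  by have := dist a b t 0 leab; have := dist m M u 0 mM; have := dist (- N) N v 0 NN; lra.
have betw_m x t : a <= t <= b -> alpha t <= x <= beta t -> m <= x <= M.
  by move=> ht hx; have [? ?] := bounds t ht; lra.
exists N, L, B, F.
(* Freezing time outside [[a, b]] extends the barriers to continuous functions on the line, as
   shooting needs. *)
pose al t := alpha (clamp a b t); pose be t := beta (clamp a b t).
have ccl : continuous (clamp a b).
  apply: (@lipschitz_continuous _ _ 1) => s t; rewrite mul1r; exact: clamp_lipschitz.
have cal : continuous al.
  move=> t; apply: (@continuous_comp _ _ _ (clamp a b) alpha); first exact: ccl.
  by apply: (ca _).2; apply: abE; exact: clamp_itv.
have cbe : continuous be.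
  move=> t; apply: (@continuous_comp _ _ _ (clamp a b) beta); first exact: ccl.
  by apply: (cb _).2; apply: abE; exact: clamp_itv.
have albe t : al t <= be t by apply: ab; apply: abE; exact: clamp_itv.
(* The state is projected onto the strip, then the excess, capped at [1], is added: it pushes upward
   above [beta] and downward below [alpha]. *)
pose G t u v := F t (clamp (al t) (be t) u) v
  + (clamp (al t - 1) (be t + 1) u - clamp (al t) (be t) u).
have G2 : lipschitz2 (L + 2) G.
  move=> t u v u' v'; rewrite /G.
  set c1 := clamp (al t) _ u; set c2 := clamp (al t) _ u'.
  set d1 := clamp (_ - 1) _ u; set d2 := clamp (_ - 1) _ u'.
  have -> : F t c1 v + (d1 - c1) - (F t c2 v' + (d2 - c2)) =
    (F t c1 v - F t c2 v') + ((d1 - d2) - (c1 - c2)) by lra.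
  apply: (le_trans (ler_normD _ _)).
  apply: (@le_trans _ _ (L * (`|c1 - c2| + `|v - v'|) + (`|d1 - d2| + `|c1 - c2|))).
    by apply: lerD; [exact: F2|exact: ler_normB].
  have h1 : `|c1 - c2| <= `|u - u'| by exact: clamp_lipschitz.
  have h2 : `|d1 - d2| <= `|u - u'| by exact: clamp_lipschitz.
  have h3 : L * (`|c1 - c2| + `|v - v'|) <= L * (`|u - u'| + `|v - v'|).
    by apply: ler_wpM2l; lra.
  by have := normr_ge0 (v - v'); lra.
have Gn : nemytskii_continuous G.
  move=> u v cu cv t.
  have cc : continuous (fun t => clamp (al t) (be t) (u t)).
    by move=> s; apply: continuous_clamp; [exact: cal|exact: cbe|exact: cu].
  apply: cvgD; first exact: Fn.
  apply: cvgB; last exact: cc.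
  apply: (@continuous_clamp _ (fun s => al s - 1) (fun s => be s + 1)); last exact: cu.
  - by apply: cvgB; [exact: cal|exact: cvg_cst].
  - by apply: cvgD; [exact: cbe|exact: cvg_cst].
have GB t u v : `|G t u v| <= B + 1.
  apply: (le_trans (ler_normD _ _)); apply: lerD => //.
  exact: clamp_widen_dist.
have L20 : 0 <= L + 2 by lra.
have [u [v [ua ub uvG]]] := dirichlet_problem (alpha a) (alpha b) ltab L20 G2 Gn GB.
have uvG' : solves_on [set t | a <= t <= b] G u v by move=> t _; exact: uvG.
have alE t : a <= t <= b -> al t = alpha t by move=> ht; rewrite /al clamp_id.
have beE t : a <= t <= b -> be t = beta t by move=> ht; rewrite /be clamp_id.
have uGe : forall t, a <= t <= b -> alpha t <= u t.
  apply: (ge_subsolution leab abE uvG' suba) => //; [by move=> y /ca[]| |by rewrite ua|by rewrite ub].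
  (* Below the strip the projected state is [alpha t], and the slope of [alpha] is under [N]; hence
     [F] returns [f] itself and only the negative penalty remains. *)
  move=> t x ht xa da; have abt := ab (abE t ht).
  have e : clamp (alpha t) (beta t) x = alpha t by apply: clamp_le => //; exact: ltW.
  rewrite /G alE// beE// e FE//; last 2 first.
  - by apply: (betw_m _ t) => //; rewrite lexx.
  - exact: (dN t ht).1.
  have : clamp (alpha t - 1) (beta t + 1) x < alpha t.
    by rewrite /clamp gt_max gt_min xa/=; lra.
  lra.
have uLe : forall t, a <= t <= b -> u t <= beta t.
  apply: (le_supersolution leab abE uvG' supb) => //; [by move=> y /cb[]| | |].
  - move=> t x ht xb db; have abt := ab (abE t ht).
    have e : clamp (alpha t) (beta t) x = beta t by apply: clamp_ge => //; exact: ltW.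
    rewrite /G alE// beE// e FE//; last 2 first.
    + by apply: (betw_m _ t) => //; rewrite lexx andbT.
    + exact: (dN t ht).2.
    have : beta t < clamp (alpha t - 1) (beta t + 1) x.
      by rewrite /clamp lt_max lt_min xb/= orbC; have -> : beta t < beta t + 1 by lra.
    lra.
  - by rewrite ua; exact: ab (abE _ haa).
  - by rewrite ub; exact: ab (abE _ hbb).
have ubetw : between a b u by move=> t ht; rewrite uGe// uLe.
have GF t : a <= t <= b -> G t (u t) (v t) = F t (u t) (v t).
  move=> ht; have /andP[h1 h2] := ubetw t ht.
  rewrite /G alE// beE// clamp_id ?h1// clamp_id ?subrr ?addr0//.
  by apply/andP; split; lra.
(* Once [u] is in the strip, [G] agrees with [f] wherever [|v| <= N], which is all the a priori
   bound asks; so the cut-off is never active. *)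
have vN : slope_bounded a b N v.
  apply: (nag u v (fun t => G t (u t) (v t))).
  - by move=> t /uvG'.
  - by move=> t ht; apply: (betw_m _ t) => //; exact: ubetw.
  - by move=> t ht vtN; rewrite GF// FE//; apply: (betw_m _ t) => //; exact: ubetw.
exists u, v; split => //.
- split => //; first by lra.
  by move=> t x y ht hx hy; apply: FE => //; exact: (betw_m _ t).
- move=> u1 v1 s1 b1; apply: (nag u1 v1 (fun t => f t (u1 t) (v1 t))) => //.
  by move=> t ht; apply: (betw_m _ t) => //; exact: b1.
- move=> t ht; have [Du Dv] := uvG' t ht; split => //.
  rewrite -FE//; [by rewrite -GF| |exact: vN].
  by apply: (betw_m _ t) => //; exact: ubetw.
Qed.

End LocalProblem.

(** * Exhaustion and passage to the limit *)

Lemma ereal_decreasing_to (R : realType) (A : \bar R) (y0 : R) : (A < y0%:E)%E ->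
  exists a : nat -> R, [/\ forall n, (A < (a n)%:E)%E, forall n, a n < y0,
    forall n k, (n <= k)%N -> a k <= a n & forall y, (A < y%:E)%E -> exists n, a n < y].
Proof.
case: A => [r|//|]; last first.
  move=> _; exists (fun n => y0 - n.+1%:R); split.
  - by move=> n; rewrite ltNyr.
  - by move=> n; rewrite ltrBlDr ltrDl ltr0n.
  - by move=> n k nk; rewrite lerD2l lerN2 ler_nat ltnS.
  - move=> y _; exists (Num.truncn (y0 - y)).
    by have := truncnS_gt (y0 - y); lra.
rewrite lte_fin => ry; have d0 : 0 < y0 - r by lra.
(* The denominator starts at [2] to keep the first point strictly below [y0]. *)
exists (fun n => r + (y0 - r) / n.+2%:R); split.
- by move=> n; rewrite lte_fin ltrDl divr_gt0.
- by move=> n; rewrite -ltrBrDl ltr_pdivrMr// ltr_pMr// ltr1n.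
- move=> n k nk; rewrite lerD2l; apply: ler_wpM2l; first exact: ltW.
  by rewrite lef_pV2 ?posrE// ler_nat !ltnS.
- move=> y; rewrite lte_fin => ry'; have d1 : 0 < y - r by lra.
  exists (Num.truncn ((y0 - r) / (y - r))).
  rewrite -ltrBrDl.
  rewrite ltr_pdivrMr// mulrC -ltr_pdivrMr//.
  by apply: lt_trans (truncnS_gt _) _; rewrite ltr_nat.
Qed.

Lemma open_interval_exhaustion (R : realType) (E : set R) (y0 : R) :
  open_interval E -> E y0 -> exists a b : nat -> R,
  [/\ forall n, a n < y0 < b n, forall n t, a n <= t <= b n -> E t,
     forall n k t, (n <= k)%N -> a n <= t <= b n -> a k <= t <= b k
   & forall y, E y -> exists n, a n < y < b n].
Proof.
move=> [A [B [_ ->]]] /= [Ay yB].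
have [a [a1 a2 a3 a4]] := ereal_decreasing_to Ay.
have NyB : (- B < (- y0)%:E)%E by rewrite EFinN lteN2.
have [b [b1 b2 b3 b4]] := ereal_decreasing_to NyB.
exists a, (fun n => - b n); split.
- by move=> n; rewrite a2 ltrNr b2.
- move=> n t /andP[at_ tb]; split; first by apply: (lt_le_trans (a1 n)); rewrite lee_fin.
  apply: (@le_lt_trans _ _ (- b n)%:E); first by rewrite lee_fin.
  by rewrite EFinN lteNl.
- by move=> n k t nk; have := a3 n k nk; have := b3 n k nk; lra.
- move=> y [Ay' yB']; have [n1 h1] := a4 y Ay'.
  have [n2 h2] : exists n, b n < - y by apply: b4; rewrite EFinN lteN2.
  exists (maxn n1 n2); have := a3 n1 (maxn n1 n2) (leq_maxl _ _).
  by have := b3 n2 (maxn n1 n2) (leq_maxr _ _); lra.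
Qed.

(** Being approached at arbitrarily large indices is enough later on, so no subsequence is
    extracted. *)
Lemma rectangle_cluster (R : realType) (p q : nat -> R) (l l' r r' : R) :
  (forall n, l <= p n <= l') -> (forall n, r <= q n <= r') ->
  exists x y : R, forall (e : R) (N : nat), 0 < e ->
    exists n, [/\ (N <= n)%N, `|x - p n| < e & `|y - q n| < e].
Proof.
move=> hp hq.
have cK : compact (`[l, l']%classic `*` `[r, r']%classic : set (R * R)).
  by apply: compact_setX; exact: segment_compact.
have FK : ((fun n => (p n, q n)) @ \oo) (`[l, l']%classic `*` `[r, r']%classic).
  by exists 0%N => // n _; split; rewrite /= in_itv/=; [exact: hp|exact: hq].
have [[x y] [_ cl]] := cK _ _ FK; exists x, y => e N e0.
have F1 : ((fun n => (p n, q n)) @ \oo) [set z | exists n, (N <= n)%N /\ z = (p n, q n)].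
  by exists N => // n /= Nn; exists n.
have [[x' y'] [[n [Nn [-> ->]]] [/= h1 h2]]] := cl _ _ F1 (nbhsx_ballx (x, y) e e0).
by exists n.
Qed.

Section Limit.
Context {R : realType}.
Variables (f : R -> R -> R -> R) (alpha beta : R -> R).

Lemma solves_on_truncation (a b N L B : R) (F : R -> R -> R -> R) (u v : R -> R) :
  truncation f alpha beta a b N L B F -> between alpha beta a b u -> slope_bounded a b N v ->
  solves_on [set t | a <= t <= b] f u v <-> solves_on [set t | a <= t <= b] F u v.
Proof.
move=> [_ _ _ _ FE] bu sv; split=> H t ht; have [Du Dv] := H t ht; split => //.
- by rewrite FE//; [exact: bu|exact: sv].
- by rewrite -FE//; [exact: bu|exact: sv].
Qed.

(** In the strip and below slope [N] the approximants solve the equation of [F] too, so closeness of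
    Cauchy data at [y0] spreads to [[a, b]]; the two conclusions are closed conditions. *)
Lemma truncation_limit (a b y0 N L B : R) (F : R -> R -> R -> R) (U V : R -> R) :
  truncation f alpha beta a b N L B F -> a <= y0 <= b ->
  (forall e : R, 0 < e -> exists u v, [/\ solves_on [set t | a <= t <= b] f u v,
     between alpha beta a b u, slope_bounded a b N v,
     `|U y0 - u y0| < e & `|V y0 - v y0| < e]) ->
  solves_on setT F U V -> between alpha beta a b U /\ slope_bounded a b N V.
Proof.
move=> tr hy0 approx sU; have [L0 F2 _ _ FE] := tr.
pose C := expR ((1 + 3 * L) * (b - a)).
have C1 : 1 <= C.
  by apply: le_trans (expR_ge1Dx _); rewrite lerDl mulr_ge0//; lra.
have close (e : R) : 0 < e -> exists u v, [/\ between alpha beta a b u, slope_bounded a b N v &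
    forall t, a <= t <= b -> `|U t - u t| <= e /\ `|V t - v t| <= e].
  (* With [C >= 1], two initial errors below [e / (2 * C)] give a squared distance of at most
     [2 * (e / (2 * C)) ^+ 2 * C <= e ^+ 2]. *)
  move=> e0; have d0 : 0 < e / (2 * C) by rewrite divr_gt0//; lra.
  have [u [v [suv bu sv h1 h2]]] := approx _ d0; exists u, v; split => // t ht.
  have sF := (solves_on_truncation tr bu sv).1 suv.
  have := solves_on_stable L0 F2 hy0 ht (fun r _ => sU r I) sF; rewrite -/C => h.
  have sq (x : R) : `|x| < e / (2 * C) -> x ^+ 2 <= (e / (2 * C)) ^+ 2.
    by move=> xe; rewrite -[leLHS]real_normK ?num_real// ler_sqr ?nnegrE//; exact: ltW.
  have k1 := sq _ h1; have k2 := sq _ h2.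
  have k3 : ((U y0 - u y0) ^+ 2 + (V y0 - v y0) ^+ 2) * C <= e ^+ 2.
    have -> : e ^+ 2 = (2 * (e / (2 * C))) ^+ 2 * C ^+ 2 by field; rewrite gt_eqF//; lra.
    apply: (@le_trans _ _ (2 * (e / (2 * C)) ^+ 2 * C ^+ 2)).
      have CC : C <= C ^+ 2 by rewrite expr2; nra.
      apply: ler_pM => //; [by rewrite addr_ge0 ?sqr_ge0|lra|lra].
    apply: ler_wpM2r; first exact: sqr_ge0.
    by have := sqr_ge0 (e / (2 * C)); rewrite exprMn; lra.
  have := sqr_ge0 (U t - u t); have := sqr_ge0 (V t - v t) => ? ?.
  by split; apply: ler_norm_sqr; rewrite ?(ltW e0)//; lra.
have le_eps (x y : R) : (forall e, 0 < e -> x <= y + e) -> x <= y.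
  by move=> H; apply/ler_addgt0Pr.
split => t ht.
- apply/andP; split; apply: le_eps => e e0; have [u [v [bu _ cl]]] := close e e0;
  have := bu t ht; have [+ _] := cl t ht; rewrite ler_norml; lra.
- apply: le_eps => e e0; have [u [v [_ sv cl]]] := close e e0.
  have -> : V t = v t + (V t - v t) by lra.
  by apply: (le_trans (ler_normD _ _)); apply: lerD; [exact: sv|exact: (cl t ht).2].
Qed.

Lemma truncation_unique (a b y0 N L B : R) (F : R -> R -> R -> R) (u1 v1 u2 v2 : R -> R) :
  truncation f alpha beta a b N L B F -> a <= y0 <= b ->
  solves_on [set t | a <= t <= b] F u1 v1 -> solves_on [set t | a <= t <= b] F u2 v2 ->
  u1 y0 = u2 y0 -> v1 y0 = v2 y0 ->
  forall t, a <= t <= b -> u1 t = u2 t /\ v1 t = v2 t.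
Proof.
move=> [L0 F2 _ _ _] hy0 s1 s2 eu ev t ht.
have := solves_on_stable L0 F2 hy0 ht s1 s2.
rewrite eu ev !subrr expr0n addr0 mul0r => h.
have := sqr_ge0 (u1 t - u2 t); have := sqr_ge0 (v1 t - v2 t) => h1 h2.
by split; apply/eqP; rewrite -subr_eq0 -sqrf_eq0 eq_le; apply/andP; split; lra.
Qed.

End Limit.

Lemma near_open_itv (R : realType) (a b x : R) : a < x < b -> \forall z \near x, a < z < b.
Proof.
move=> /andP[ax xb]; have : \forall z \near x, z \in `]a, b[.
  by apply: near_in_itvoo; rewrite in_itv/= ax.
by apply: filterS => z; rewrite in_itv.
Qed.

Lemma global_solution_of_system (R : realType) (E1 E2t : set R) (f : R -> R -> R -> R)
    (u v : R -> R) :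
  (forall y, E1 y -> \forall z \near y, E1 z) -> (forall y, E1 y -> E2t (u y)) ->
  solves_on E1 f u v -> (forall y, E1 y -> {for y, continuous (fun t => f t (u t) (v t))}) ->
  global_solution E1 E2t f u.
Proof.
move=> oE1 uE2 S cf.
have u1 z : E1 z -> u^`()%classic z = v z.
  by move=> /S[Du _]; rewrite derive1E derive_val.
have du1 z : E1 z -> is_derive z 1 u^`()%classic (f z (u z) (v z)).
  move=> Ez; refine (near_eq_is_derive _ (S z Ez).2).
  by apply: filterS (oE1 z Ez) => t /u1.
have u2 z : E1 z -> u^`()^`()%classic z = f z (u z) (v z).
  by move=> /du1 D; rewrite derive1E derive_val.
move=> y Ey; split; first exact: uE2.
split; first by have [Du _] := S y Ey; exact: ex_derive.
split; first by have D := du1 y Ey; exact: ex_derive.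
split; last by rewrite u2// u1.
rewrite /prop_for /continuous_at u2//.
apply: cvg_trans (cf y Ey); apply: near_eq_cvg.
by apply: filterS (oE1 y Ey) => z /u2.
Qed.

Unset Implicit Arguments.

Theorem theorem6p10 (R : realType) (E1 E2 E2t : set R) (f : R -> R -> R -> R)
  (alpha beta : R -> R) :
  open_interval E1 -> open_interval E2 ->
  E2 `<=` E2t -> E2t `<=` closure E2 ->
  cont_on3 (fun y u => E1 y /\ E2t u) f ->
  loc_lipschitz_on3 (fun y u => E1 y /\ E2 u) f ->
  nagumo E1 E2t f ->
  cont_into E1 E2 alpha -> cont_into E1 E2 beta ->
  classX E1 E2t alpha -> classX E1 E2t beta ->
  (forall y, E1 y -> alpha y <= beta y) ->
  subsolution E1 f alpha -> supersolution E1 f beta ->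
  exists u : R -> R, global_solution E1 E2t f u /\
    (forall y, E1 y -> alpha y <= u y <= beta y).
Proof.
move=> oE1 oE2 E2E2t _ _ lipf nagf ca cb Xa Xb ab suba supb.
have [[y0 Ey0]|E0] := pselect (exists y, E1 y); last first.
  by exists alpha; split => y Ey; exfalso; apply: E0; exists y.
have [a [b [aby abE abmono abex]]] := open_interval_exhaustion oE1 Ey0.
have aby' n : a n <= y0 <= b n by have := aby n; lra.
have /choice [N /choice [L /choice [B /choice [F /choice [u0 /choice [v0 loc]]]]]] :
    forall n, exists (N L B : R) (F : R -> R -> R -> R) (u v : R -> R),
    [/\ truncation f alpha beta (a n) (b n) N L B F,
      forall u v, solves_on [set t | a n <= t <= b n] f u v ->
        between alpha beta (a n) (b n) u -> slope_bounded (a n) (b n) N v,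
      solves_on [set t | a n <= t <= b n] f u v & between alpha beta (a n) (b n) u].
  move=> n; apply: (local_problem oE2 E2E2t lipf nagf ca cb Xa Xb ab suba supb).
    by have := aby n; lra.
  exact: abE.
have slope n := let: And4 _ h _ _ := loc n in h.
have trunc n := let: And4 h _ _ _ := loc n in h.
(* A solution from the larger interval [k] inherits the slope bound [N n], independent of [k], on
   the smaller one. *)
have sub n k u v : (n <= k)%N -> solves_on [set t | a k <= t <= b k] f u v ->
    between alpha beta (a k) (b k) u ->
    [/\ solves_on [set t | a n <= t <= b n] f u v, between alpha beta (a n) (b n) u
      & slope_bounded (a n) (b n) (N n) v].
  move=> nk s1 b1.
  have s2 : solves_on [set t | a n <= t <= b n] f u v.
    by move=> t /= ht; apply: s1; exact: abmono nk ht.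
  have b2 : between alpha beta (a n) (b n) u.
    by move=> t ht; apply: b1; exact: abmono nk ht.
  by split => //; exact: slope s2 b2.
have sub0 n k (nk : (n <= k)%N) := let: And4 _ _ s1 b1 := loc k in sub n k _ _ nk s1 b1.
(* All solutions satisfy the slope bound of the smallest interval, so their Cauchy data at [y0] lie
   in one rectangle. *)
have [|n|p [q clus]] := @rectangle_cluster R (fun n => u0 n y0) (fun n => v0 n y0)
    (alpha y0) (beta y0) (- N 0%N) (N 0%N).
- by move=> n; have [_ _ _ bu] := loc n; exact: bu.
- by have [_ _ sv] := sub0 0%N n (leq0n n); rewrite -ler_norml; exact: sv.
have /choice [U /choice [V sUV]] : forall n, exists U V : R -> R,
    [/\ U y0 = p, V y0 = q & solves_on setT (F n) U V].
  by move=> n; have [L0 F2 Fc FB _] := trunc n; exact: picard L0 F2 Fc FB.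
have UV n : between alpha beta (a n) (b n) (U n) /\ slope_bounded (a n) (b n) (N n) (V n).
  have [Up Vq s] := sUV n.
  apply: (truncation_limit (trunc n) (aby' n) _ s) => e e0.
  have [k [nk h1 h2]] := clus e n e0; exists (u0 k), (v0 k).
  have [s1 b1 sl1] := sub0 n k nk.
  by rewrite Up Vq.
have sF n : solves_on [set t | a n <= t <= b n] (F n) (U n) (V n).
  by move=> t _; have [_ _] := sUV n; exact.
have sf n : solves_on [set t | a n <= t <= b n] f (U n) (V n).
  by apply/(solves_on_truncation (trunc n) (UV n).1 (UV n).2).
(* [U n] and [U k] come from different truncations. On the interval of index [n], [U k] solves the
   original equation in the strip with slope at most [N n], hence the equation of [F n], where
   uniqueness applies. *)
have agree n k t : (n <= k)%N -> a n <= t <= b n -> U n t = U k t /\ V n t = V k t.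
  move=> nk ht; have [s1 b1 sl1] := sub n k _ _ nk (sf k) (UV k).1.
  have [Un Vn _] := sUV n; have [Uk Vk _] := sUV k.
  apply: (truncation_unique (trunc n) (aby' n) (sF n)); rewrite ?Un ?Vn//.
  exact/(solves_on_truncation (trunc n) b1 sl1).
have agree' n k t : a n <= t <= b n -> a k <= t <= b k -> U n t = U k t /\ V n t = V k t.
  by move=> hn hk; have [/agree/(_ hn)//|/ltnW/agree/(_ hk)[-> ->]] := leqP n k.
(* The strict inequalities make [u] coincide with [U (idx y)] on a neighbourhood of [y]. *)
have /choice [idx hidx] : forall y, exists n, E1 y -> a n < y < b n.
  move=> y; have [/abex[n hn]|nE] := pselect (E1 y); first by exists n.
  by exists 0%N.
have E1itv n t : a n < t < b n -> E1 t by move=> ht; apply: (abE n); lra.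
pose u y := U (idx y) y; pose v y := V (idx y) y.
have uvE n t : a n < t < b n -> u t = U n t /\ v t = V n t.
  by move=> ht; have := hidx t (E1itv n t ht) => h; apply: agree'; lra.
have near_uv y : E1 y -> \forall z \near y, u z = U (idx y) z /\ v z = V (idx y) z.
  by move=> /hidx/near_open_itv; apply: filterS => z; exact: uvE.
have betw y : E1 y -> alpha y <= u y <= beta y.
  by move=> /hidx h; apply: (UV (idx y)).1; lra.
exists u; split => //; apply: (@global_solution_of_system _ _ _ _ _ v).
- by move=> y /hidx/near_open_itv; apply: filterS => z; exact: E1itv.
- move=> y Ey; apply: E2E2t.
  exact: convex_open_interval oE2 (ca y Ey).1 (cb y Ey).1 (betw y Ey).
- move=> y Ey; have h := hidx y Ey.
  have [|Du Dv] := sf (idx y) y; first by rewrite /=; lra.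
  split.
  + refine (near_eq_is_derive _ Du).
    by apply: filterS (near_uv y Ey) => z [].
  + refine (near_eq_is_derive _ Dv).
    by apply: filterS (near_uv y Ey) => z [].
(* Near [y], [f] along [u] and [v] equals [F n] along the globally continuous [U n] and [V n], so
   its continuity is inherited from [F n]. *)
- move=> y Ey; set n := idx y; have h := hidx y Ey; rewrite -/n in h.
  have [_ _ Fc _ FE] := trunc n; have [_ _ s] := sUV n.
  have cU : continuous (U n) by move=> t; exact: is_derive_continuous (s t I).1.
  have cV : continuous (V n) by move=> t; exact: is_derive_continuous (s t I).2.
  have e z : a n < z < b n -> F n z (U n z) (V n z) = f z (u z) (v z).
    move=> hz; have [-> ->] := uvE n z hz; have hz' : a n <= z <= b n by lra.
    by apply: FE => //; [exact: (UV n).1|exact: (UV n).2].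
  rewrite /prop_for /continuous_at -e//.
  apply: cvg_trans (Fc _ _ cU cV y); apply: near_eq_cvg.
  by apply: filterS (near_open_itv h) => z hz; rewrite e.
Qed.
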